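(* Let $q\geq 5$ be a prime power, let $\ell_\infty$ be a line of $\mathrm{PG}(2,q^2)$, and let $\mathcal B$ be a set of $q^2+q+1$ points in $\mathrm{PG}(2,q^2)$ such that $T=\mathcal B\cap\ell_\infty$ is a (single) point. Then $\mathcal B$ is a Baer subplane of $\mathrm{PG}(2,q^2)$ if and only if every $\ell_\infty$-Baer pencil meets $\mathcal B$ in either a point; one or two Baer sublines; or a non-degenerate $\mathbb F_q$-conic.
   Context: A Baer subplane of $\mathrm{PG}(2,q^2)$ is an image of $\mathrm{PG}(2,q)$ under a projectivity of $\mathrm{PG}(2,q^2)$. A Baer subline is a set of $q+1$ points of a line of $\mathrm{PG}(2,q^2)$ that is projectively equivalent to $\mathrm{PG}(1,q)\subset\mathrm{PG}(1,q^2)$. A non-degenerate $\mathbb F_q$-conic is a non-degenerate conic contained in some Baer subplane (i.e. the image of a non-degenerate conic of $\mathrm{PG}(2,q)$ under a projectivity of $\mathrm{PG}(2,q^2)$). A Baer pencil in $\mathrm{PG}(2,q^2)$ is the cone of $q+1$ lines joining a vertex point $P$ to the points of a Baer subline $b$, called its base (where $b$ lies on a line not through $P$); it contains $q^2(q+1)+1$ points. An $\ell_\infty$-Baer pencil is a Baer pencil containing the line $\ell_\infty$, so its vertex lies on $\ell_\infty$ and its base $b$ meets $\ell_\infty$ in a point. ''Meets $\mathcal B$ in'' a configuration means that the intersection with $\mathcal B$, as a set of points, equals that configuration (for two Baer sublines: the union of two distinct Baer sublines). *)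

(* Defs.v *)
From mathcomp Require Import all_boot all_algebra.

Set Implicit Arguments.
Unset Strict Implicit.
Unset Printing Implicit Defensive.

Import GRing.Theory.
Local Open Scope ring_scope.

(* The projective subspaces of dimension d of PG(n, F): the vector subspaces of
   F^(n+1) of rank d.+1. A vector subspace is the row space of a matrix, and
   <<A>> is the canonical matrix with the row space of A, so that each subspace
   is represented exactly once and = is equality of subspaces. *)
Definition pgspace (F : fieldType) (n d : nat) :=
  {A : 'M[F]_n.+1 | (<<A>>%MS == A) && (\rank A == d.+1)}.

Notation point F n := (pgspace F n 0).
Notation line F n := (pgspace F n 1).

Definition line_points (F : finFieldType) n (l : line F n) : {set point F n} :=
  [set P | (val P <= val l)%MS].

(* A conic is the zero set of a quadratic form. Forms are written
   v |-> v A v^T with A an arbitrary (not necessarily symmetric) matrix, so that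
   every quadratic form is covered in characteristic 2 as well. *)
Definition qform (K : fieldType) (A : 'M[K]_3) (v : 'rV[K]_3) : K :=
  (v *m A *m v^T) 0 0.

Definition polar (K : fieldType) (A : 'M[K]_3) (v w : 'rV[K]_3) : K :=
  qform A (v + w) - qform A v - qform A w.

(* Non-degenerate quadratic form, in any characteristic: no nonzero vector is
   both singular and orthogonal to the whole space. *)
Definition nondegenerate_qform (K : fieldType) (A : 'M[K]_3) : Prop :=
  forall v, qform A v = 0 -> (forall w, polar A v w = 0) -> v = 0.

Definition conic (K : finFieldType) (A : 'M[K]_3) : {set point K 2} :=
  [set P | [forall v : 'rV[K]_3, (v <= val P)%MS ==> (qform A v == 0)]].

(* In the following iota : K -> F is the inclusion of GF(q) in GF(q^2). *)

(* The image in PG(n, F) of a set D of points of PG(m, K), where PG(m, K) is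
   first included in PG(m, F) and then mapped by the collineation <v> |-> <v M>;
   M is to be row-free, so for m = n this collineation is a projectivity of
   PG(n, F), and for m < n it is a projectivity of PG(m, F) onto an
   m-dimensional subspace of PG(n, F). *)
Definition proj_image (K F : finFieldType) (iota : {rmorphism K -> F}) m n
    (M : 'M[F]_(m.+1, n.+1)) (D : {set point K m}) : {set point F n} :=
  [set P | [exists Q in D, (val P == map_mx iota (val Q) *m M)%MS]].

Section Baer.
Variables (K F : finFieldType) (iota : {rmorphism K -> F}).

Definition Baer_subplane (B : {set point F 2}) : Prop :=
  exists2 M : 'M[F]_3, M \in unitmx & B = proj_image iota M [set: point K 2].

Definition Baer_subline (b : {set point F 2}) : Prop :=
  exists2 M : 'M[F]_(2, 3),
    row_free M & b = proj_image iota M [set: point K 1].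

Definition nondegenerate_Fq_conic (C : {set point F 2}) : Prop :=
  exists (M : 'M[F]_3) (A : 'M[K]_3),
    [/\ M \in unitmx, nondegenerate_qform A & C = proj_image iota M (conic A)].

(* The points of the lines joining P to the points of b. *)
Definition cone (P : point F 2) (b : {set point F 2}) : {set point F 2} :=
  [set X | [exists Q in b, (val X <= val P + val Q)%MS]].

Definition Baer_pencil (S : {set point F 2}) : Prop :=
  exists (P : point F 2) (b : {set point F 2}) (l : line F 2),
    [/\ Baer_subline b, b \subset line_points l, P \notin line_points l
      & S = cone P b].

Definition linf_Baer_pencil (linf : line F 2) (S : {set point F 2}) : Prop :=
  Baer_pencil S /\ line_points linf \subset S.

End Baer.

(* Main.v *)
Require Import Defs.
From mathcomp Require Import all_boot all_algebra.
From mathcomp Require Import ring zify.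

Set Implicit Arguments.
Unset Strict Implicit.
Unset Printing Implicit Defensive.

(** Write [q = #|K|] and choose [T] and the line at infinity as in the theorem.

    A Baer subplane satisfies the condition because, in coordinates adapted to a
    pencil, belonging to the pencil means that two linear forms [f], [h] have their
    ratio in [K]. On the [K]-rational points of the subplane, [f = a + tau b] and
    [h = c + tau d] with [K]-linear forms [a], [b], [c], [d], and the condition
    becomes the quadratic equation [ad = bc] over [K]. Its zero set is a
    non-degenerate conic, a point, a line or two lines ([conic_cases]), unless the
    form vanishes; that is impossible for a pencil containing a line with only one
    point in the subplane ([const_ratio]).

    Conversely, the affine lines through a point [P] at infinity form a copy of
    [F], and the pencils with vertex [P] containing the line at infinity are the
    lines of [AG(2, K)] on it ([pencil_coordinate]). So for each [P] the set [B]
    without [T] becomes a weight function on an affine plane of order [q], with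
    total weight [q^2 + q] and strongly restricted line weights.
    - For [P = T], a subline inside a pencil lies on one of its lines, and counting
      shows that every line joining [T] to another point of [B] meets [B] in a Baer
      subline ([T_fiber_subline]).
    - For [P] different from [T], all line weights are [0], [q] or [2q]
      ([over_cases]), so a point of weight [w > 0] lies on exactly [w] lines of
      weight [2q] ([card_heavy_dirs]). A point of weight at least [2] is on two
      such lines, and if its affine line did not meet [B] in a Baer subline then
      both pencils would contain a common subline through [T]
      ([secant_subline]).
    Thus every line with two points of [B] meets [B] in a Baer subline. Then any two
    of these secants meet in [B] by counting, so that a frame contained in [B]
    generates inside [B] all the points rational over [K] with respect to it
    ([subplane_of_secants]). *)

Import GRing.Theory.
Local Open Scope ring_scope.

(** * Points as nonzero vectors *)

Section Points.
Variables (F : fieldType) (n : nat).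
Implicit Types (v w : 'rV[F]_n.+1) (P : point F n).

Lemma genmx_point v :
  v != 0 -> (<<(<<v>>%MS)>>%MS == <<v>>%MS) && (\rank <<v>>%MS == 1%N).
Proof. by move=> v0; rewrite genmx_id eqxx genmxE rank_rV v0. Qed.

Lemma delta0_neq0 : delta_mx 0 0 != 0 :> 'rV[F]_n.+1.
Proof.
by apply/eqP => /matrixP/(_ 0 0)/eqP; rewrite !mxE /= oner_eq0.
Qed.

(** The point spanned by [v]; the zero vector is sent to an arbitrary point. *)
Definition pt v : point F n :=
  insubd (exist _ <<delta_mx 0 0>>%MS (genmx_point delta0_neq0)) <<v>>%MS.

(** A canonical nonzero representative of a point. *)
Definition vec P : 'rV[F]_n.+1 := nz_row (val P).

Lemma val_pt v : v != 0 -> (val (pt v) :=: v)%MS.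
Proof.
by move=> v0; rewrite /pt insubdK ?unfold_in /=; [exact: genmxE|exact: genmx_point].
Qed.

Lemma vec_neq0 P : vec P != 0.
Proof.
rewrite /vec nz_row_eq0 -mxrank_eq0.
by case/andP: (valP P) => _ /eqP ->.
Qed.

Lemma val_vec P : (val P :=: vec P)%MS.
Proof.
apply: eqmx_sym; apply/eqmxP; rewrite /vec -(geq_leqif (mxrank_leqif_eq (nz_row_sub _))).
by case/andP: (valP P) => _ /eqP ->; rewrite rank_rV vec_neq0.
Qed.

Lemma point_inj P Q : (val P == val Q)%MS -> P = Q.
Proof.
move=> /eqmxP e; apply: val_inj.
case/andP: (valP P) (valP Q) => /eqP {2}<- _ /andP[/eqP {2}<- _].
by apply/genmxP/eqmxP.
Qed.

Lemma vecK P : pt (vec P) = P.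
Proof.
apply: point_inj; apply/eqmxP; apply: (eqmx_trans (val_pt (vec_neq0 P))).
exact/eqmx_sym/val_vec.
Qed.

Lemma ptP P : exists2 v, v != 0 & P = pt v.
Proof. by exists (vec P); rewrite ?vecK ?vec_neq0. Qed.

Lemma eq_pt v w : v != 0 -> w != 0 -> (pt v == pt w) = (v <= w)%MS.
Proof.
move=> v0 w0; apply/eqP/idP => [e|vw].
  by rewrite -(eqmxP (introT eqmxP (val_pt v0))) e val_pt.
apply: point_inj; apply/eqmxP.
apply: (eqmx_trans (val_pt v0)); apply: eqmx_sym.
apply: (eqmx_trans (val_pt w0)); apply: eqmx_sym; apply/eqmxP.
by rewrite -(geq_leqif (mxrank_leqif_eq vw)) !rank_rV v0 w0.
Qed.

Lemma pt_scale a v : a != 0 -> v != 0 -> pt (a *: v) = pt v.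
Proof.
move=> a0 v0; apply/eqP; rewrite eq_pt ?scaler_eq0 ?negb_or ?a0 //.
exact: scalemx_sub.
Qed.

Lemma pt_inj v w : v != 0 -> w != 0 -> pt v = pt w ->
  exists2 a, a != 0 & v = a *: w.
Proof.
move=> v0 w0 /eqP; rewrite eq_pt // => /sub_rVP [a e]; exists a => //.
by apply: contraNneq v0 => a0; rewrite e a0 scale0r.
Qed.

Definition indep v w := (v != 0) && ~~ (w <= v)%MS.

Lemma indepP v w : reflect (forall a b, a *: v + b *: w = 0 -> a = 0 /\ b = 0) (indep v w).
Proof.
apply: (iffP andP) => [[v0 nwv] a b e|h].
  have b0 : b = 0.
    apply/eqP; apply: contraNT nwv => b0; apply/sub_rVP; exists (- (b^-1 * a)).
    move/eqP: e; rewrite addrC addr_eq0 => /eqP e.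
    by rewrite scaleNr -scalerA -scalerN -e scalerA mulVf // scale1r.
  split=> //; move/eqP: e; rewrite b0 scale0r addr0 scaler_eq0 (negPf v0) orbF.
  by move/eqP.
split; first by apply/eqP => v0; have [] := h 1 0; rewrite ?v0 ?scaler0 ?scale0r ?addr0 // => /eqP; rewrite oner_eq0.
apply/negP => /sub_rVP[a e]; have [] := h a (-1); first by rewrite e scaleN1r subrr.
by move=> _ /eqP; rewrite oppr_eq0 oner_eq0.
Qed.

Lemma indep_neq0 v w : indep v w -> v != 0 /\ w != 0.
Proof.
by case/andP => v0 nwv; split=> //; apply: contraNneq nwv => ->; exact: sub0mx.
Qed.

Lemma indep_pt v w : v != 0 -> w != 0 -> indep v w = (pt v != pt w).
Proof. by move=> v0 w0; rewrite /indep v0 eq_sym eq_pt. Qed.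

End Points.

(** * Lines of the plane as kernels of linear forms *)

Section Incidence.
Variable F : finFieldType.
Implicit Types (u v w : 'rV[F]_3) (g h : 'cV[F]_3) (X Y Z : point F 2).

Definition dot g v : F := (v *m g) 0 0.

Lemma dotD g v w : dot g (v + w) = dot g v + dot g w.
Proof. by rewrite /dot mulmxDl mxE. Qed.

Lemma dotZ g a v : dot g (a *: v) = a * dot g v.
Proof. by rewrite /dot -scalemxAl mxE. Qed.

Lemma dotN g v : dot g (- v) = - dot g v.
Proof. by rewrite /dot mulNmx mxE. Qed.

Lemma dot_eq0 g v : (dot g v == 0) = (v *m g == 0).
Proof.
apply/eqP/eqP => [e|e]; last by rewrite /dot e mxE.
by apply/matrixP => i j; rewrite !ord1 [RHS]mxE.
Qed.

Definition form_line g : {set point F 2} := [set X | dot g (vec X) == 0].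

Lemma in_form_line g v : v != 0 -> (pt v \in form_line g) = (dot g v == 0).
Proof.
move=> v0; rewrite inE; have [a a0 ->] := pt_inj (vec_neq0 (pt v)) v0 (vecK _).
by rewrite dotZ mulf_eq0 (negPf a0).
Qed.

Definition is_line (L : {set point F 2}) := exists2 g, g != 0 & L = form_line g.

Lemma rank_ker_form g : g != 0 -> \rank (kermx g) = 2%N.
Proof.
move=> g0; rewrite mxrank_ker; suff -> : \rank g = 1%N by [].
by apply/eqP; rewrite -mxrank_tr rank_rV trmx_eq0 g0.
Qed.

Lemma indep_rank u v : indep u v -> \rank (u + v)%MS = 2%N.
Proof.
case/andP=> u0 nvu; apply/eqP; rewrite eqn_leq; apply/andP; split.
  apply: leq_trans (mxrank_adds_leqif _ _) _.
  exact: (leq_add (rank_leq_row u) (rank_leq_row v)).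
have : (u < u + v)%MS.
  by rewrite ltmxE addsmxSl /=; apply: contra nvu; apply: submx_trans (addsmxSr _ _).
by move/rank_ltmx; rewrite rank_rV u0.
Qed.

(** The kernel of a nonzero form on a 3-dimensional space is a plane, so two
    independent vectors of it span it. Most incidence arguments below reduce to
    this one. *)
Lemma span2 g u v w : g != 0 -> indep u v -> dot g u = 0 -> dot g v = 0 ->
  dot g w = 0 -> exists a b, w = a *: u + b *: v.
Proof.
move=> g0 iuv /eqP gu /eqP gv /eqP gw.
have s x : dot g x == 0 -> (x <= kermx g)%MS.
  by rewrite dot_eq0 => /eqP e; apply/sub_kermxP.
have le : (u + v <= kermx g)%MS by rewrite addsmx_sub !s.
have : (w <= u + v)%MS.
  apply: (submx_trans (s _ gw)).
  by rewrite -(geq_leqif (mxrank_leqif_sup le)) indep_rank // rank_ker_form.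
case/sub_addsmxP => -[x y] /= ->.
exists (x 0 0), (y 0 0); rewrite [x]mx11_scalar [y]mx11_scalar.
by rewrite !mul_scalar_mx !mxE /= !mulr1n.
Qed.

Lemma line_eq L1 L2 X Y : is_line L1 -> is_line L2 -> X != Y ->
  X \in L1 -> Y \in L1 -> X \in L2 -> Y \in L2 -> L1 = L2.
Proof.
suff sub g h : g != 0 -> X != Y -> X \in form_line g -> Y \in form_line g ->
    X \in form_line h -> Y \in form_line h -> form_line g \subset form_line h.
  move=> [g g0 ->] [h h0 ->] *; apply/eqP; rewrite eqEsubset.
  by rewrite !sub.
rewrite -{1}(vecK X) -{1}(vecK Y) -indep_pt ?vec_neq0 // !inE.
move=> g0 iXY /eqP Xg /eqP Yg /eqP Xh /eqP Yh; apply/subsetP => Z; rewrite !inE => /eqP Zg.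
have [a [b ->]] := span2 g0 iXY Xg Yg Zg.
by rewrite dotD !dotZ Xh Yh !mulr0 addr0.
Qed.

Lemma form_through u v : exists2 g, g != 0 & dot g u = 0 /\ dot g v = 0.
Proof.
have : (0 < \rank (cokermx (u + v)%MS))%N.
  rewrite mxrank_coker subn_gt0 ltnS.
  apply: leq_trans (mxrank_adds_leqif _ _) _.
  exact: (leq_add (rank_leq_row u) (rank_leq_row v)).
rewrite lt0n mxrank_eq0 => c0.
have [j cj] : exists j, col j (cokermx (u + v)%MS) != 0.
  apply/existsP; apply: contraNT c0 => /existsPn h; apply/eqP/matrixP => i j.
  by have /eqP/matrixP/(_ i 0) := negbNE (h j); rewrite !mxE.
exists (col j (cokermx (u + v)%MS)) => //.
have s x : (x <= u + v)%MS -> dot (col j (cokermx (u + v)%MS)) x = 0.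
  by rewrite submxE => /eqP e; apply/eqP; rewrite dot_eq0 colE mulmxA e mul0mx eqxx.
by split; apply: s; rewrite ?addsmxSl ?addsmxSr.
Qed.

Lemma line_through X Y : exists2 L, is_line L & (X \in L) && (Y \in L).
Proof.
have [g g0 [gX gY]] := form_through (vec X) (vec Y).
by exists (form_line g); [exists g|rewrite !inE gX gY eqxx].
Qed.

Lemma lines_meet L1 L2 : is_line L1 -> is_line L2 ->
  exists2 X, X \in L1 & X \in L2.
Proof.
move=> [g g0 ->] [h h0 ->].
have : kermx (row_mx g h) != 0.
  rewrite -mxrank_eq0 mxrank_ker -lt0n subn_gt0.
  by apply: leq_ltn_trans (rank_leq_col _) _.
move=> k0; have v0 : nz_row (kermx (row_mx g h)) != 0 by rewrite nz_row_eq0.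
have /sub_kermxP : (nz_row (kermx (row_mx g h)) <= kermx (row_mx g h))%MS by exact: nz_row_sub.
rewrite mul_mx_row -[0]row_mx0 => /eq_row_mx[e1 e2].
by exists (pt (nz_row (kermx (row_mx g h)))); rewrite in_form_line // dot_eq0 ?e1 ?e2.
Qed.

Lemma ker_form_other g u : g != 0 -> u != 0 -> exists2 v, dot g v = 0 & indep u v.
Proof.
move=> g0 u0; have : ~~ (kermx g <= u)%MS.
  by apply: contraL u0 => /mxrankS; rewrite rank_ker_form // rank_rV; case: eqP.
case/row_subPn => i ni; exists (row i (kermx g)); last by rewrite /indep u0.
by apply/eqP; rewrite dot_eq0; apply/eqP/sub_kermxP; exact: row_sub.
Qed.

Lemma form_eq1 g : g != 0 -> exists v, dot g v = 1.
Proof.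
move=> g0; have [i gi] : exists i, g i 0 != 0.
  apply/existsP; apply: contraNT g0 => /existsPn h; apply/eqP/matrixP => i j.
  by rewrite (ord1 j) mxE; apply/eqP/negbNE.
exists ((g i 0)^-1 *: delta_mx 0 i).
by rewrite dotZ /dot -rowE mxE mulVf.
Qed.

Lemma line_pointsP (l : line F 2) :
  exists2 g, g != 0 & line_points l = form_line g /\
    forall v, (v <= val l)%MS = (dot g v == 0).
Proof.
have rl : \rank (val l) = 2%N by case/andP: (valP l) => _ /eqP.
have c0 : cokermx (val l) != 0 by rewrite -mxrank_eq0 mxrank_coker rl.
have [j cj] : exists j, col j (cokermx (val l)) != 0.
  apply/existsP; apply: contraNT c0 => /existsPn h; apply/eqP/matrixP => i j.
  by have /eqP/matrixP/(_ i 0) := negbNE (h j); rewrite !mxE.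
have E v : (v <= val l)%MS = (dot (col j (cokermx (val l))) v == 0).
  set g := col j _ in cj *.
  have le : (val l <= kermx g)%MS.
    by apply/sub_kermxP; rewrite /g colE mulmxA mulmx_coker mul0mx.
  have /eqmxP e : (val l == kermx g)%MS.
    by rewrite -(geq_leqif (mxrank_leqif_eq le)) rl rank_ker_form.
  by rewrite e dot_eq0; apply/sub_kermxP/eqP.
exists (col j (cokermx (val l))) => //; split => //.
by apply/setP => X; rewrite !inE -E val_vec.
Qed.

End Incidence.

(** * Counting points and projective images *)

(** Each point is spanned by [#|F| - 1] of the nonzero vectors. *)
Lemma card_point (F : finFieldType) n :
  (#|{: point F n}| * #|F|.-1 = (#|F| ^ n.+1).-1)%N.
Proof.
transitivity #|[set~ (0 : 'rV[F]_n.+1)]|; last first.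
  by rewrite cardsC1 card_mx mul1n.
rewrite -sum1_card (partition_big (@pt F n) predT) //=.
rewrite -sum_nat_const; apply: eq_bigr => P _; rewrite sum1dep_card.
have -> : [set v | (v \in [set~ 0]) && (pt v == P)]
    = [set a *: vec P | a in [set~ (0 : F)]].
  apply/setP => v; rewrite !inE; apply/andP/imsetP => [[v0 /eqP e]|[a]].
    by have [] := pt_inj v0 (vec_neq0 P); rewrite ?vecK // => a a0 ->; exists a; rewrite // !inE.
  rewrite !inE => a0 ->; rewrite scaler_eq0 negb_or a0 vec_neq0; split=> //.
  by rewrite pt_scale ?vecK ?vec_neq0.
rewrite card_in_imset ?cardsC1 // => a b _ _ /eqP.
by rewrite -subr_eq0 -scalerBl scaler_eq0 (negPf (vec_neq0 P)) orbF subr_eq0 => /eqP.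
Qed.

Lemma card_gt1 (F : finFieldType) : (1 < #|F|)%N.
Proof. exact: card_finNzRing_gt1. Qed.

Lemma card_point1 (F : finFieldType) : #|{: point F 1}| = #|F|.+1.
Proof.
have := card_point F 1; have := card_gt1 F; case: #|F| => [|[|k]] // _ /= h.
apply/eqP; rewrite -(eqn_pmul2r (ltn0Sn k)) h; apply/eqP.
by rewrite -[RHS]/(k.+3 * k.+1)%N !expnS expn0; nia.
Qed.

Lemma card_point2 (F : finFieldType) : #|{: point F 2}| = (#|F| ^ 2 + #|F| + 1)%N.
Proof.
have := card_point F 2; have := card_gt1 F; case: #|F| => [|[|k]] // _ /= h.
apply/eqP; rewrite -(eqn_pmul2r (ltn0Sn k)) h; apply/eqP.
by rewrite !expnS expn0; nia.
Qed.

Definition rows2 (F : fieldType) n (r s : 'rV[F]_n) : 'M[F]_(2, n) :=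
  \matrix_i (if i == 0 then r else s).

Lemma mul_rows2 (F : fieldType) n (x : 'rV[F]_2) (r s : 'rV[F]_n) :
  x *m rows2 r s = x 0 0 *: r + x 0 1 *: s.
Proof.
rewrite mulmx_sum_row !big_ord_recl big_ord0 addr0 !rowK /=.
by rewrite (_ : lift _ _ = 1) //; apply: val_inj.
Qed.

Lemma mul_row2 (F : fieldType) (a b : F) n (r s : 'rV[F]_n) :
  (\row_i (if i == 0 then a else b)) *m rows2 r s = a *: r + b *: s.
Proof. by rewrite mul_rows2 !mxE. Qed.

Lemma row2_eq0 (F : fieldType) (a b : F) :
  (\row_(i < 2) (if i == 0 then a else b) == 0) = (a == 0) && (b == 0).
Proof.
apply/eqP/andP => [/matrixP h|[/eqP -> /eqP ->]].
  by have := h 0 0; have := h 0 1; rewrite !mxE /= => -> ->.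
by apply/matrixP => i j; rewrite !mxE; case: ifP.
Qed.

Lemma row_free_rows2 (F : fieldType) n (r s : 'rV[F]_n.+1) :
  indep r s -> row_free (rows2 r s).
Proof.
move/indepP => h; apply: inj_row_free => x; rewrite mul_rows2 => /h[x0 x1].
apply/matrixP => i j; rewrite ord1 !mxE.
by case: j => [[|[|//]] ?]; [rewrite -[RHS]x0|rewrite -[RHS]x1]; congr (x _ _); apply: val_inj.
Qed.

(** A row-free [M] maps independent vectors over [K] to independent vectors over
    [F], because extension of scalars preserves rank; hence [proj_image] is the
    image of an injective map. *)
Section ProjImage.
Variables (K F : finFieldType) (iota : {rmorphism K -> F}) (m n : nat).
Variables (M : 'M[F]_(m.+1, n.+1)) (freeM : row_free M).
Implicit Types (D : {set point K m}) (x y : 'rV[K]_m.+1).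

Lemma image_neq0 x : x != 0 -> map_mx iota x *m M != 0.
Proof.
by move=> x0; rewrite -mxrank_eq0 mxrankMfree // mxrank_eq0 map_mx_eq0.
Qed.

Lemma image_inj x y : x != 0 -> y != 0 ->
  pt (map_mx iota x *m M) = pt (map_mx iota y *m M) -> pt x = pt y.
Proof.
move=> x0 y0 /eqP; rewrite eq_pt ?image_neq0 // submxMfree // map_submx.
by rewrite -eq_pt // => /eqP.
Qed.

Lemma proj_imageE D :
  proj_image iota M D = [set pt (map_mx iota (vec Q) *m M) | Q in D].
Proof.
apply/setP => P; rewrite inE.
have E Q : (val P == map_mx iota (val Q) *m M)%MS
    = (P == pt (map_mx iota (vec Q) *m M)).
  have v0 := image_neq0 (vec_neq0 Q).
  have e : (map_mx iota (val Q) *m M :=: map_mx iota (vec Q) *m M)%MS.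
    apply: eqmxMr; apply/eqmxP; rewrite !map_submx.
    by rewrite !(val_vec Q) submx_refl.
  rewrite !e; apply/idP/eqP => [h|->]; last by rewrite !val_pt // submx_refl.
  by apply: point_inj; rewrite !val_pt.
apply/existsP/imsetP => [[Q /andP[DQ]]|[Q DQ e]].
  by rewrite E => /eqP ->; exists Q.
by exists Q; rewrite DQ E e eqxx.
Qed.

Lemma proj_imageP D P :
  reflect (exists x, [/\ x != 0, pt x \in D & P = pt (map_mx iota x *m M)])
          (P \in proj_image iota M D).
Proof.
rewrite proj_imageE; apply: (iffP imsetP) => [[Q DQ ->]|[x [x0 Dx ->]]].
  by exists (vec Q); rewrite vec_neq0 vecK.
exists (pt x) => //; have [a a0 ->] := pt_inj (vec_neq0 (pt x)) x0 (vecK _).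
by rewrite map_mxZ -scalemxAl pt_scale ?fmorph_eq0 ?image_neq0.
Qed.

Lemma mem_proj_image D x : x != 0 ->
  (pt (map_mx iota x *m M) \in proj_image iota M D) = (pt x \in D).
Proof.
move=> x0; apply/proj_imageP/idP => [[y [y0 Dy]]|Dx]; last by exists x.
by move/(image_inj x0 y0) ->.
Qed.

Lemma card_proj_image D : #|proj_image iota M D| = #|D|.
Proof.
rewrite proj_imageE card_in_imset // => P Q _ _ e.
by rewrite -(vecK P) -(vecK Q); apply: image_inj; rewrite ?vec_neq0.
Qed.

End ProjImage.

(** * Baer sublines *)

Section Sublines.
Variables (K F : finFieldType) (iota : {rmorphism K -> F}).
Implicit Types (b : {set point F 2}).

Lemma card_subline b : Baer_subline iota b -> #|b| = #|K|.+1.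
Proof.
by case=> M fM ->; rewrite card_proj_image // cardsT card_point1.
Qed.

Lemma subline_line b : Baer_subline iota b -> exists2 L, is_line L & b \subset L.
Proof.
case=> M fM ->; have [g g0 [g1 g2]] := form_through (row 0 M) (row 1 M).
exists (form_line g); first by exists g.
apply/subsetP => P /(proj_imageP _ fM)[x [x0 _ ->]].
rewrite in_form_line ?image_neq0 // mulmx_sum_row !big_ord_recl big_ord0 addr0.
rewrite (_ : lift _ _ = 1); last exact: val_inj.
by rewrite dotD !dotZ g1 g2 !mulr0 addr0.
Qed.

(** Three points of a projective line determine its Baer subline: scaling the
    representatives [v], [w] so that the third point is spanned by [v + w] fixes
    the [K]-structure on their span. *)
Lemma subline_span b (v w : 'rV[F]_3) : Baer_subline iota b -> indep v w ->
  pt v \in b -> pt w \in b -> pt (v + w) \in b ->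
  forall c d : K, (c != 0) || (d != 0) -> pt (iota c *: v + iota d *: w) \in b.
Proof.
case=> M fM -> ivw; have [v0 w0] := indep_neq0 ivw.
have vw0 : v + w != 0.
  apply/eqP => e; have [] := (indepP _ _ ivw) 1 1; first by rewrite !scale1r.
  by move/eqP; rewrite oner_eq0.
case/(proj_imageP _ fM) => x [x0 _ /(pt_inj v0 (image_neq0 iota fM x0))[a a0 ev]].
case/(proj_imageP _ fM) => y [y0 _ /(pt_inj w0 (image_neq0 iota fM y0))[a' a'0 ew]].
case/(proj_imageP _ fM) => z [z0 _ /(pt_inj vw0 (image_neq0 iota fM z0))[e e0 evw]] c d cd.
have ixy : indep x y.
  apply/andP; split=> //; apply/negP => /sub_rVP[k ek].
  case/andP: ivw => _ /negP; apply; apply/sub_rVP; exists (a' * iota k * a^-1).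
  by rewrite ew ev ek map_mxZ -scalemxAl !scalerA mulfVK.
have [k [l ez]] : exists k l, z = k *: x + l *: y.
  have : (z <= rows2 x y)%MS.
    by apply: submx_full; rewrite row_full_unit -row_free_unit; exact: row_free_rows2.
  by case/submxP => u ->; rewrite mul_rows2; exists (u 0 0), (u 0 1).
have : (a - e * iota k) *: (map_mx iota x *m M) + (a' - e * iota l) *: (map_mx iota y *m M) = 0.
  rewrite !scalerBl addrACA -ev -ew evw ez map_mxD !map_mxZ mulmxDl -!scalemxAl.
  by rewrite scalerDr !scalerA -opprD subrr.
have /indepP ixyM : indep (map_mx iota x *m M) (map_mx iota y *m M).
  by rewrite /indep image_neq0 //= submxMfree // map_submx; case/andP: ixy.
case/ixyM => /eqP; rewrite subr_eq0 => /eqP ea /eqP; rewrite subr_eq0 => /eqP ea'.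
have -> : iota c *: v + iota d *: w
    = e *: (map_mx iota ((c * k) *: x + (d * l) *: y) *m M).
  rewrite map_mxD !map_mxZ mulmxDl -!scalemxAl scalerDr !scalerA ev ew ea ea'.
  by rewrite !scalerA !rmorphM /=; congr (_ *: _ + _ *: _); ring.
have n0 : (c * k) *: x + (d * l) *: y != 0.
  apply/eqP => /(indepP _ _ ixy)[/eqP + /eqP]; rewrite !mulf_eq0.
  have /negPf -> : k != 0 by apply: contraNneq a0; rewrite ea => ->; rewrite rmorph0 mulr0.
  have /negPf -> : l != 0 by apply: contraNneq a'0; rewrite ea' => ->; rewrite rmorph0 mulr0.
  by rewrite !orbF => c0 d0; move: cd; rewrite c0 d0.
rewrite pt_scale // ?image_neq0 //; apply/(proj_imageP _ fM).
by eexists; split; [exact: n0|rewrite inE|].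
Qed.

End Sublines.

(** * Non-degenerate conics *)

Section QuadraticForms.
Variables (K : finFieldType) (A : 'M[K]_3).
Implicit Types (u v w x y z : 'rV[K]_3).

Definition bil v w : K := (v *m A *m w^T) 0 0.

Lemma bilDl u v w : bil (u + v) w = bil u w + bil v w.
Proof. by rewrite /bil !mulmxDl mxE. Qed.

Lemma bilDr u v w : bil w (u + v) = bil w u + bil w v.
Proof. by rewrite /bil linearD mulmxDr mxE. Qed.

Lemma bilZl a v w : bil (a *: v) w = a * bil v w.
Proof. by rewrite /bil -!scalemxAl mxE. Qed.

Lemma bilZr a v w : bil v (a *: w) = a * bil v w.
Proof. by rewrite /bil linearZ -!scalemxAr mxE. Qed.

Lemma qform_bil v : qform A v = bil v v. Proof. by []. Qed.

Lemma polar_bil v w : polar A v w = bil v w + bil w v.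
Proof. by rewrite /polar !qform_bil !bilDl !bilDr; ring. Qed.

Definition bilE := (polar_bil, qform_bil, bilDl, bilDr, bilZl, bilZr).

Lemma qform3 a b c x y z : qform A (a *: x + b *: y + c *: z) =
  a ^+ 2 * qform A x + b ^+ 2 * qform A y + c ^+ 2 * qform A z
  + a * b * polar A x y + a * c * polar A x z + b * c * polar A y z.
Proof. by rewrite !bilE; ring. Qed.

Lemma qform2 a b x y : qform A (a *: x + b *: y) =
  a ^+ 2 * qform A x + b ^+ 2 * qform A y + a * b * polar A x y.
Proof. by rewrite !bilE; ring. Qed.

Lemma qformZ a x : qform A (a *: x) = a ^+ 2 * qform A x.
Proof. by rewrite !bilE; ring. Qed.

Lemma polarC x y : polar A x y = polar A y x.
Proof. by rewrite !bilE; ring. Qed.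

Lemma polarD x y z : polar A x (y + z) = polar A x y + polar A x z.
Proof. by rewrite !bilE; ring. Qed.

Lemma polarZ a x y : polar A x (a *: y) = a * polar A x y.
Proof. by rewrite !bilE; ring. Qed.

Lemma polarDl x y z : polar A (x + y) z = polar A x z + polar A y z.
Proof. by rewrite !bilE; ring. Qed.

Lemma polarZl a x y : polar A (a *: x) y = a * polar A x y.
Proof. by rewrite !bilE; ring. Qed.

Lemma polarxx x : polar A x x = qform A x + qform A x.
Proof. by rewrite !bilE; ring. Qed.

Definition polar_form x : 'cV[K]_3 := (A + A^T) *m x^T.

Lemma dot_polar_form x w : dot (polar_form x) w = polar A x w.
Proof.
rewrite /dot /polar_form mulmxA mulmxDr mulmxDl mxE polar_bil addrC; congr (_ + _).
rewrite /bil -[LHS](mxE trmx_key (fun i j => (w *m A^T *m x^T) j i)).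
by rewrite -/(trmx _) !trmx_mul !trmxK mulmxA.
Qed.

Lemma in_conic x : x != 0 -> (pt x \in conic A) = (qform A x == 0).
Proof.
move=> x0; rewrite inE; apply/forallP/idP => [/(_ x)|/eqP qx v].
  by rewrite val_pt // submx_refl.
apply/implyP; rewrite val_pt // => /sub_rVP[a ->].
by rewrite qformZ qx mulr0.
Qed.

Hypothesis nondegA : nondegenerate_qform A.

Lemma nondeg_polar x : x != 0 -> qform A x = 0 -> polar_form x != 0.
Proof.
move=> x0 qx; apply: contraNneq x0 => p0; apply/eqP/nondegA => // w.
by rewrite -dot_polar_form p0 /dot mulmx0 mxE.
Qed.

(** On a totally singular line the two polar forms of its points both vanish on
    that line, so they are proportional; some point of the line then lies in the
    radical, against non-degeneracy. *)
Lemma no_singular_line x y :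
  indep x y -> qform A x = 0 -> qform A y = 0 -> polar A x y != 0.
Proof.
move=> ixy qx qy; have [x0 y0] := indep_neq0 ixy; apply/eqP => pxy.
have fx0 := nondeg_polar x0 qx; have [w fw] := form_eq1 fx0.
have pxx : polar A x x = 0 by rewrite polarxx qx addr0.
have pyy : polar A y y = 0 by rewrite polarxx qy addr0.
pose s := polar A y w.
have : - s *: x + 1 *: y = 0.
  apply: nondegA; first by rewrite qform2 qx qy pxy !mulr0 !addr0.
  move=> u; have : dot (polar_form x) (u - polar A x u *: w) = 0.
    by rewrite dotD dotN dotZ fw mulr1 dot_polar_form subrr.
  have fx : dot (polar_form x) x = 0 by rewrite dot_polar_form.
  have fy : dot (polar_form x) y = 0 by rewrite dot_polar_form.
  case/(span2 fx0 ixy fx fy) => a [b /eqP]; rewrite subr_eq => /eqP ->.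
  rewrite !polarDl !polarZl !polarD !polarZ.
  rewrite pxx pxy (polarC y x) pxy pyy -/s (_ : polar A x w = 1) -?dot_polar_form //.
  by ring.
by case/(indepP _ _ ixy) => _ /eqP; rewrite oner_eq0.
Qed.

(** Projection from a point of the conic: each line through it other than the
    tangent meets the conic in exactly one further point, and the tangent in
    none. *)
Lemma card_conic P : P \in conic A -> #|conic A| = #|K|.+1.
Proof.
have [x x0 ->] := ptP P; rewrite in_conic // => /eqP qx.
have fx0 := nondeg_polar x0 qx; have [z fz] := form_eq1 fx0.
have fx : dot (polar_form x) x = 0 by rewrite dot_polar_form polarxx qx addr0.
have [h fh ixh] := ker_form_other fx0 x0.
(* [g t] runs over the secants through [x], [f t] is the second point on each. *)
pose g t := t *: h + z; pose f t := - qform A (g t) *: x + g t.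
have ff t : dot (polar_form x) (f t) = 1.
  by rewrite dotD dotZ fx mulr0 add0r dotD dotZ fh mulr0 add0r.
have f0 t : f t != 0.
  by apply: contraTneq (oner_neq0 K) => e; rewrite -(ff t) e /dot mul0mx mxE eqxx.
have qf t : qform A (f t) = 0.
  rewrite /f -[g t in X in qform A X]scale1r qform2 qx mulr0 add0r -dot_polar_form.
  by rewrite !scale1r dotD dotZ fh mulr0 add0r fz; ring.
have -> : conic A = pt x |: [set pt (f t) | t in K].
  apply/setP => P'; have [v v0 ->] := ptP P'; rewrite in_conic // !inE.
  have := span2 fx0 ixh fx fh (w := v - dot (polar_form x) v *: z).
  rewrite dotD dotN dotZ fz mulr1 subrr => /(_ erefl)[a [b /eqP]].
  rewrite subr_eq; set u := dot _ v => /eqP ev.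
  apply/eqP/orP => [qv|[/eqP/(pt_inj v0 x0)[c c0 ->]|/imsetP[t _ /(pt_inj v0 (f0 t))[c c0 ->]]]];
    rewrite ?qformZ ?qx ?qf ?mulr0 //.
  have [u0|u0] := eqVneq u 0.
    left; move: ev; rewrite u0 scale0r addr0 => ev.
    have: b = 0.
      apply/eqP; apply/negPn/negP => b0; have := no_singular_line ixh qx.
      move: qv; rewrite ev qform2 qx mulr0 add0r -dot_polar_form fh mulr0 addr0.
      move/eqP; rewrite mulf_eq0 expf_eq0 /= (negPf b0) => /eqP -> /(_ erefl).
      by rewrite eqxx.
    move=> b0; move: v0; rewrite ev b0 scale0r addr0 scaler_eq0 negb_or => /andP[a0 _].
    by rewrite pt_scale.
  right; apply/imsetP; exists (b / u) => //.
  have eg : g (b / u) = u^-1 *: (b *: h + u *: z).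
    by rewrite /g scalerDr !scalerA mulVf // scale1r mulrC.
  suff -> : v = u *: f (b / u) by rewrite pt_scale.
  rewrite /f scalerDr eg [u *: (u^-1 *: _)]scalerA divff // scale1r [LHS]ev -addrA.
  congr (_ + _); rewrite scalerA; congr (_ *: _).
  move: qv; rewrite ev -addrA -[b *: h + u *: z]scale1r qform2 qx mulr0 add0r qformZ.
  rewrite -dot_polar_form dotD !dotZ fh fz mulr0 add0r !mulr1 expr1n mul1r.
  by move/eqP; rewrite addr_eq0 scale1r => /eqP ->; field.
rewrite cardsU1 card_imset => [|t t' e]; last first.
  have [c c0] := pt_inj (f0 t) (f0 t') e => /[dup] e1 /(congr1 (dot (polar_form x))).
  rewrite dotZ !ff mulr1 => c1; move: e1; rewrite -c1 scale1r => /eqP.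
  rewrite -subr_eq0 /f /g opprD addrACA -scalerBl opprD addrACA subrr addr0 -scalerBl.
  by move/eqP/(indepP _ _ ixh) => [_ /eqP]; rewrite subr_eq0 => /eqP.
suff -> : pt x \notin [set pt (f t) | t in K] by [].
apply/imsetP => -[t _ /(pt_inj x0 (f0 t))[c c0 /(congr1 (dot (polar_form x)))]].
by rewrite dotZ fx ff mulr1 => /esym/eqP; rewrite (negPf c0).
Qed.

End QuadraticForms.

Section FqConic.
Variables (K F : finFieldType) (iota : {rmorphism K -> F}).

Lemma card_Fq_conic C P :
  nondegenerate_Fq_conic iota C -> P \in C -> #|C| = #|K|.+1.
Proof.
case=> M [A [uM nA ->]]; move: uM; rewrite -row_free_unit => fM.
case/(proj_imageP _ fM) => x [x0 cx _].
by rewrite card_proj_image // (card_conic nA cx).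
Qed.

(** No three points of an [F_q]-conic are collinear, even over the big field:
    collinear points of a Baer subplane are already collinear in it, and a line
    of the subplane with three singular points is totally singular. *)
Lemma Fq_conic_line C L X Y Z : nondegenerate_Fq_conic iota C -> is_line L ->
  X \in C -> Y \in C -> Z \in C -> X \in L -> Y \in L -> Z \in L ->
  X != Y -> X != Z -> Y != Z -> False.
Proof.
case=> M [A [uM nA ->]] [g g0 ->]; move: uM; rewrite -row_free_unit => fM.
case/(proj_imageP _ fM) => x [x0 cx ->]; case/(proj_imageP _ fM) => y [y0 cy ->].
case/(proj_imageP _ fM) => z [z0 cz ->].
have N u v : u != 0 -> v != 0 -> (pt (map_mx iota u *m M) != pt (map_mx iota v *m M)) -> indep u v.
  move=> u0 v0; rewrite indep_pt //; apply: contraNneq => e.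
  have [a a0 ->] := pt_inj u0 v0 e.
  by rewrite map_mxZ -scalemxAl pt_scale ?fmorph_eq0 ?image_neq0.
rewrite !in_form_line ?image_neq0 // => /eqP gx /eqP gy /eqP gz nxy nxz nyz.
have ixy := N _ _ x0 y0 nxy; have ixz := N _ _ x0 z0 nxz; have iyz := N _ _ y0 z0 nyz.
move: cx cy cz; rewrite !in_conic // => /eqP qx /eqP qy /eqP qz.
have ixyM : indep (map_mx iota x *m M) (map_mx iota y *m M).
  by rewrite indep_pt ?image_neq0.
have : (z <= rows2 x y)%MS.
  rewrite -(map_submx iota) -(submxMfree _ _ fM).
  have [a [b ->]] := span2 g0 ixyM gx gy gz.
  have xR : (x <= rows2 x y)%MS by have := row_sub 0 (rows2 x y); rewrite rowK.
  have yR : (y <= rows2 x y)%MS by have := row_sub 1 (rows2 x y); rewrite rowK.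
  by rewrite addmx_sub // scalemx_sub // submxMr // map_submx.
case/submxP => u; rewrite mul_rows2; set a := u 0 0; set b := u 0 1 => ez.
have a0 : a != 0.
  apply: contraTneq iyz => a0; rewrite /indep ez a0 scale0r add0r.
  by rewrite scalemx_sub ?andbF.
have b0 : b != 0.
  apply: contraTneq ixz => b0; rewrite /indep ez b0 scale0r addr0.
  by rewrite scalemx_sub ?andbF.
move: qz; rewrite ez qform2 qx qy !mulr0 !add0r => /eqP.
by rewrite !mulf_eq0 (negPf a0) (negPf b0) (negPf (no_singular_line nA ixy qx qy)).
Qed.

End FqConic.

(** * Baer pencils in coordinates *)

Section Forms.
Variables (F : finFieldType).
Implicit Types (f g h : 'cV[F]_3) (u v w : 'rV[F]_3).

Lemma dotDf f g v : dot (f + g) v = dot f v + dot g v.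
Proof. by rewrite /dot mulmxDr mxE. Qed.

Lemma dotZf a f v : dot (a *: f) v = a * dot f v.
Proof. by rewrite /dot -scalemxAr mxE. Qed.

Lemma form_ext f g : (forall v, dot f v = dot g v) -> f = g.
Proof.
move=> e; apply/matrixP => i j; have := e (delta_mx 0 i).
by rewrite /dot -!rowE !mxE (ord1 j).
Qed.

Lemma ker_form_basis g : g != 0 ->
  exists u v, [/\ indep u v, dot g u = 0 & dot g v = 0].
Proof.
move=> g0; have [u gu /indep_neq0[_ u0]] := ker_form_other g0 (delta0_neq0 F 2).
by have [v gv iuv] := ker_form_other g0 u0; exists u, v.
Qed.

Lemma span3 g u v w x : indep u v -> dot g u = 0 -> dot g v = 0 -> dot g w != 0 ->
  exists a b c, x = a *: u + b *: v + c *: w.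
Proof.
move=> iuv gu gv gw.
have g0 : g != 0 by apply: contraNneq gw => ->; rewrite /dot mulmx0 mxE.
have := span2 g0 iuv gu gv (w := x - (dot g x / dot g w) *: w).
rewrite dotD dotN dotZ divfK // subrr => /(_ erefl)[a [b /eqP]].
by rewrite subr_eq => /eqP ->; exists a, b, (dot g x / dot g w).
Qed.

Lemma dual_basis g u v w : indep u v -> dot g u = 0 -> dot g v = 0 -> dot g w != 0 ->
  exists f h, [/\ forall x, exists s, x = dot f x *: u + dot h x *: v + s *: w,
     dot f u = 1 /\ dot h u = 0, dot f v = 0 /\ dot h v = 1
     & dot f w = 0 /\ dot h w = 0].
Proof.
move=> iuv gu gv gw; have S x := span3 x iuv gu gv gw.
have N f : f != 0 -> dot f w = 0 -> (dot f u != 0) || (dot f v != 0).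
  move=> f0 fw; apply: contraNT f0; rewrite negb_or !negbK => /andP[/eqP fu /eqP fv].
  apply/eqP/form_ext => x; have [a [b [c ->]]] := S x.
  by rewrite [RHS]/dot mulmx0 mxE !dotD !dotZ fu fv fw !mulr0 !addr0.
have [f f0 [fw fv]] := form_through w v.
have fu : dot f u != 0 by move: (N f f0 fw); rewrite fv eqxx orbF.
have [h h0 [hw hu]] := form_through w u.
have hv : dot h v != 0 by move: (N h h0 hw); rewrite hu eqxx.
exists ((dot f u)^-1 *: f), ((dot h v)^-1 *: h).
rewrite !dotZf fw fv hw hu !mulr0 !mulVf //; split=> // x.
have [a [b [c ->]]] := S x; exists c; rewrite !dotZf !dotD !dotZ fw fv hw hu.
by congr (_ *: _ + _ *: _ + _); field.
Qed.

End Forms.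

Section Pencils.
Variables (K F : finFieldType) (iota : {rmorphism K -> F}).
Implicit Types (f g h : 'cV[F]_3) (u v w p : 'rV[F]_3) (S : {set point F 2}).

(** The condition that [(x : y)] lies on [PG(1, K)], with [x = y = 0] allowed so
    that the vertex of a pencil needs no special treatment. *)
Definition Baer_ratio (x y : F) :=
  exists (t : F) (c d : K), x = t * iota c /\ y = t * iota d.

(** In coordinates adapted to the base and the vertex, the projection from the
    vertex forgets the last coordinate. *)
Lemma in_cone (R : 'M[F]_(2, 3)) p f h : row_free R -> p != 0 ->
  (forall x, exists s, x = dot f x *: row 0 R + dot h x *: row 1 R + s *: p) ->
  dot f (row 0 R) = 1 /\ dot h (row 0 R) = 0 ->
  dot f (row 1 R) = 0 /\ dot h (row 1 R) = 1 ->
  dot f p = 0 /\ dot h p = 0 ->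
  forall v, v != 0 ->
  pt v \in cone (pt p) (proj_image iota R [set: point K 1]) <-> Baer_ratio (dot f v) (dot h v).
Proof.
move=> fR p0 S [f1 h1] [f2 h2] [fp hp] v v0.
have rowR (x : 'rV[K]_2) :
    map_mx iota x *m R = iota (x 0 0) *: row 0 R + iota (x 0 1) *: row 1 R.
  rewrite mulmx_sum_row !big_ord_recl big_ord0 addr0 !mxE.
  by rewrite (_ : lift _ _ = 1) //; apply: val_inj.
have memc : pt v \in cone (pt p) (proj_image iota R [set: point K 1]) <->
    exists2 x : 'rV[K]_2, x != 0 & (v <= p + map_mx iota x *m R)%MS.
  have E x : x != 0 -> (val (pt v) <= val (pt p) + val (pt (map_mx iota x *m R)))%MS
      = (v <= p + map_mx iota x *m R)%MS.
    move=> x0; rewrite (val_pt v0).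
    by rewrite (adds_eqmx (val_pt p0) (val_pt (image_neq0 iota fR x0))).
  rewrite inE; split=> [/existsP[Q /andP[/(proj_imageP _ fR)[x [x0 _ ->]]]]|[x x0 le]].
    by rewrite E // => le; exists x.
  apply/existsP; exists (pt (map_mx iota x *m R)); rewrite E // le andbT.
  by apply/(proj_imageP _ fR); exists x; split=> //; rewrite inE.
split=> [/memc[x x0 /sub_addsmxP[[a b] /= ev]]|[t [c [d [ef eh]]]]].
  exists (b 0 0), (x 0 0), (x 0 1).
  rewrite ev [a]mx11_scalar [b]mx11_scalar !mul_scalar_mx rowR !mxE /= !mulr1n.
  by rewrite !dotD !dotZ !dotD !dotZ f1 f2 h1 h2 fp hp; split; ring.
apply/memc; have [s ev] := S v.
have [/eqP|cd] := boolP ((\row_(i < 2) (if i == 0 then c else d)) == 0).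
  move/eqP; rewrite row2_eq0 => /andP[/eqP c0 /eqP d0].
  exists (\row_(i < 2) (if i == 0 then 1 else 0)).
    by rewrite row2_eq0 oner_eq0.
  apply: submx_trans (addsmxSl _ _).
  rewrite ev ef eh c0 d0 !rmorph0 !mulr0 !scale0r !add0r.
  exact: scalemx_sub.
exists (\row_(i < 2) (if i == 0 then c else d)) => //.
rewrite ev ef eh rowR !mxE /= -!scalerA -scalerDr addrC.
by apply: addmx_sub_adds; apply: scalemx_sub.
Qed.

Lemma pencil_forms S : Baer_pencil iota S -> exists f h,
  [/\ exists v, dot f v = 1 /\ dot h v = 0, exists v, dot f v = 0 /\ dot h v = 1
    & forall v, v != 0 -> pt v \in S <-> Baer_ratio (dot f v) (dot h v)].
Proof.
case=> P [b [l [[R fR eb] sbl Pl ->]]]; have [p p0 eP] := ptP P.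
have [g g0 [el gl]] := line_pointsP l.
have R0 (x : 'rV[K]_2) : x != 0 -> dot g (map_mx iota x *m R) = 0.
  move=> x0; apply/eqP; rewrite -in_form_line ?image_neq0 // -el; apply: (subsetP sbl).
  by rewrite eb mem_proj_image ?inE.
have Ri (i : 'I_2) : dot g (row i R) = 0.
  have := R0 (delta_mx 0 i); rewrite map_delta_mx -rowE; apply.
  by apply/eqP => /matrixP/(_ 0 i)/eqP; rewrite !mxE !eqxx oner_eq0.
have gp : dot g p != 0 by move: Pl; rewrite el eP in_form_line.
have iR : indep (row 0 R) (row 1 R).
  apply/indepP => x y e.
  have /eqP : (\row_(i < 2) (if i == 0 then x else y)) *m R = 0.
    rewrite mulmx_sum_row !big_ord_recl big_ord0 addr0 !mxE /=.
    by rewrite (_ : lift _ _ = 1) //; apply: val_inj.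
  by rewrite mulmx_free_eq0 // row2_eq0 => /andP[/eqP -> /eqP ->].
have [f [h [B Bu Bv Bw]]] := dual_basis iR (Ri 0) (Ri 1) gp.
exists f, h; split; [by exists (row 0 R)|by exists (row 1 R)|].
by rewrite eP eb; exact: in_cone.
Qed.

End Pencils.

(** * Quadrics of the plane over a finite field *)

Section ConicCases.
Variables (K : finFieldType) (A : 'M[K]_3).
Implicit Types (x y v w : 'rV[K]_3).

Definition kline x y : {set point K 2} := [set Q | (val Q <= rows2 x y)%MS].

Lemma in_kline x y v : v != 0 ->
  reflect (exists a b, v = a *: x + b *: y) (pt v \in kline x y).
Proof.
move=> v0; rewrite inE val_pt //; apply: (iffP submxP) => [[u ->]|[a [b ->]]].
  by rewrite mul_rows2; exists (u 0 0), (u 0 1).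
by exists (\row_(i < 2) (if i == 0 then a else b)); rewrite mul_row2.
Qed.

(** A radical singular vector [v] makes the quadric a cone with vertex [v]; if it
    contains two points that are not collinear with [v], the form is a nonzero
    multiple of a product of two coordinates, or zero. *)
Lemma conic_cases :
  [\/ nondegenerate_qform A, forall x, qform A x = 0,
      exists2 v, v != 0 & conic A = [set pt v]
    | exists x y z, [/\ indep x y, indep x z & conic A = kline x y \/
        conic A = kline x y :|: kline x z /\ pt z \notin kline x y]].
Proof.
have [/existsP[v /and3P[v0 /eqP qv /forallP pv]]|N] :=
  boolP [exists v, [&& v != 0, qform A v == 0 & [forall w, polar A v w == 0]]]; last first.
  constructor 1 => v qv pv; apply/eqP; apply: contraNT N => v0.
  by apply/existsP; exists v; rewrite v0 qv eqxx; apply/forallP => w; rewrite pv.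
have [/existsP[r /andP[irv /eqP qr]]|N] := boolP [exists r, indep v r && (qform A r == 0)]; last first.
  constructor 3; exists v => //; apply/setP => P; have [r r0 ->] := ptP P.
  rewrite in_conic // inE; apply/idP/eqP => [qr|/(pt_inj r0 v0)[a _ ->]]; last first.
    by rewrite qformZ qv mulr0.
  apply/eqP; apply: contraNT N => n; apply/existsP; exists r.
  by rewrite indep_pt // eq_sym n.
have kz x : indep v x -> qform A x = 0 -> kline v x \subset conic A.
  move=> ivx qx; apply/subsetP => P; have [u u0 ->] := ptP P.
  move/(in_kline _ _ u0) => [a [b e]]; rewrite in_conic // e qform2 qv qx.
  by rewrite (eqP (pv x)) !mulr0 !addr0.
have [sub|] := boolP (conic A \subset kline v r).
  constructor 4; exists v, r, r; split=> //; left.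
  by apply/eqP; rewrite eqEsubset sub kz.
case/subsetPn => P; have [s s0 ->] := ptP P; rewrite in_conic // => /eqP qs ns.
have [g g0 [gv gr]] := form_through v r.
have gs : dot g s != 0.
  apply: contraNneq ns => gs; apply/(in_kline _ _ s0).
  exact: span2 g0 irv gv gr gs.
have ivs : indep v s.
  rewrite indep_pt //; apply: contraNneq ns => e; apply/(in_kline _ _ s0).
  by have [a a0 ->] := pt_inj s0 v0 (esym e); exists a, 0; rewrite scale0r addr0.
have q3 a b c : qform A (a *: v + b *: r + c *: s) = b * c * polar A r s.
  by rewrite qform3 qv qr qs !(eqP (pv _)); ring.
have [prs|prs] := eqVneq (polar A r s) 0.
  constructor 2 => x; have [a [b [c ->]]] := span3 x irv gv gr gs.
  by rewrite q3 prs mulr0.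
constructor 4; exists v, r, s; split=> //; right; split=> //; apply/setP => Q.
have [x x0 ->] := ptP Q; rewrite in_setU.
apply/idP/orP => [|[]];
  [|exact: (subsetP (kz _ irv qr) (pt x))|exact: (subsetP (kz _ ivs qs) (pt x))].
rewrite in_conic //; have [a [b [c ex]]] := span3 x irv gv gr gs.
rewrite ex q3 !mulf_eq0 (negPf prs) orbF -ex => /orP[]/eqP e0.
  by right; apply/(in_kline _ _ x0); exists a, c; rewrite ex e0 scale0r addr0.
by left; apply/(in_kline _ _ x0); exists a, b; rewrite ex e0 scale0r addr0.
Qed.

End ConicCases.

(** * A tangent Baer subplane meets the pencils as required *)

Section SubplaneMeetsPencil.
Variables (K F : finFieldType) (iota : {rmorphism K -> F}).
Hypothesis cardF : #|F| = (#|K| ^ 2)%N.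
Implicit Types (f g h : 'cV[F]_3) (S B : {set point F 2}).

Lemma quadratic_basis : exists tau : F,
  (forall c d : K, iota c + tau * iota d = 0 -> c = 0 /\ d = 0)
  /\ forall z, exists c d, z = iota c + tau * iota d.
Proof.
have [tau /imsetP ntau] : exists tau, tau \notin [set iota c | c in K].
  apply/existsP; apply: contraT => /existsPn h.
  have : (#|F| <= #|[set iota c | c in K]|)%N.
    by apply: subset_leq_card; apply/subsetP => x _; apply: negbNE.
  rewrite card_imset; last exact: fmorph_inj.
  by rewrite cardF -[X in (_ <= X)%N]expn1 leq_exp2l // card_gt1.
have inj c d : iota c + tau * iota d = 0 -> c = 0 /\ d = 0.
  move=> e; have d0 : d = 0.
    apply/eqP; apply: contraPT e => d0 /eqP; rewrite addrC addr_eq0 => /eqP e.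
    apply: ntau; exists (- c / d) => //.
    by rewrite rmorphM fmorphV rmorphN /= -e mulfK // fmorph_eq0.
  by move: e; rewrite d0 rmorph0 mulr0 addr0 => /eqP; rewrite fmorph_eq0 => /eqP.
exists tau; split=> // z.
pose phi (x : K * K) := iota x.1 + tau * iota x.2.
have phi_inj : injective phi.
  move=> [c d] [c' d'] /eqP; rewrite -subr_eq0 /phi /= opprD addrACA -mulrBr -!rmorphB.
  by move/eqP/inj => [/eqP + /eqP]; rewrite !subr_eq0 => /eqP -> /eqP ->.
have : z \in codom phi.
  by apply: inj_card_onto => //; rewrite card_prod cardF mulnn.
by case/codomP => -[c d] ->; exists c, d.
Qed.

(** Over the [K]-basis [1, tau] of [F] the ratio of two elements is in [K] iff
    their coordinate vectors are proportional. This turns the equation of a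
    pencil into a quadratic one over [K]. *)
Lemma Baer_ratioE tau (a b c d : K) :
  (forall c d : K, iota c + tau * iota d = 0 -> c = 0 /\ d = 0) ->
  (forall z, exists c d, z = iota c + tau * iota d) ->
  Baer_ratio iota (iota a + tau * iota b) (iota c + tau * iota d) <-> a * d = b * c.
Proof.
move=> inj onto.
have inj2 (a1 b1 a2 b2 : K) : iota a1 + tau * iota b1 = iota a2 + tau * iota b2 -> a1 = a2 /\ b1 = b2.
  move/eqP; rewrite -subr_eq0 opprD addrACA -mulrBr -!rmorphB => /eqP/inj[/eqP + /eqP].
  by rewrite !subr_eq0 => /eqP -> /eqP ->.
split=> [[t [k [l []]]]|e].
  have [s [s' ->]] := onto t; rewrite !mulrDl -!mulrA -!rmorphM => /inj2[-> ->] /inj2[-> ->].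
  by ring.
have [b0|b0] := eqVneq b 0; last first.
  exists (iota a + tau * iota b), 1, (d / b); rewrite rmorph1 mulr1; split=> //.
  rewrite mulrDl -mulrA -!rmorphM /=; congr (iota _ + tau * iota _); last by field.
  by apply: (mulfI b0); rewrite -e; field.
have [a0|a0] := eqVneq a 0; last first.
  exists (iota a + tau * iota b), 1, (c / a); rewrite rmorph1 mulr1; split=> //.
  rewrite mulrDl -mulrA -!rmorphM /=; congr (iota _ + tau * iota _); first by field.
  by apply: (mulfI a0); rewrite e; field.
exists (iota c + tau * iota d), 0, 1; rewrite a0 b0 !rmorph0 rmorph1 !mulr0 addr0.
by rewrite mulr1.
Qed.

Lemma form_decomp tau f : (forall z, exists c d, z = iota c + tau * iota d) ->
  exists a b : 'cV[K]_3, forall x,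
    dot f (map_mx iota x) = iota (dot a x) + tau * iota (dot b x).
Proof.
move=> onto.
have /fin_all_exists[c /fin_all_exists[d e]] :
  forall i : 'I_3, exists c, exists d, f i 0 = iota c + tau * iota d by move=> i; exact: onto.
exists (\col_i c i), (\col_i d i) => x.
rewrite /dot !mxE !rmorph_sum mulr_sumr -big_split; apply: eq_bigr => i _ /=.
by rewrite !mxE e !rmorphM /=; ring.
Qed.

(** A line all of whose points have their image on [PG(1, K)] under the
    projection from the vertex is a line of the pencil: otherwise the projection
    would map it onto the whole of [PG(1, F)], including the point [(1 : tau)]
    outside [PG(1, K)]. *)
Lemma pencil_line_form f h (g : 'cV[F]_3) :
  g != 0 ->
  (exists v, dot f v = 1 /\ dot h v = 0) -> (exists v, dot f v = 0 /\ dot h v = 1) ->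
  (forall v, v != 0 -> dot g v = 0 -> Baer_ratio iota (dot f v) (dot h v)) ->
  exists k l : K, forall v, (dot g v == 0) = (iota l * dot f v - iota k * dot h v == 0).
Proof.
move=> g0 [v1 [fv1 hv1]] [v2 [fv2 hv2]] R.
have [tau [inj onto]] := quadratic_basis.
have [u [v [iuv gu gv]]] := ker_form_basis g0.
have D0 : dot f u * dot h v - dot f v * dot h u = 0.
  apply/eqP; apply: contraT => D0; set D := _ - _ in D0.
  (* [w] is the point of the line that projects to [(1 : tau)]. *)
  pose w := ((dot h v - tau * dot f v) / D) *: u + ((tau * dot f u - dot h u) / D) *: v.
  have fw : dot f w = 1.
    by rewrite dotD !dotZ /D; field.
  have hw : dot h w = tau.
    by rewrite dotD !dotZ /D; field.
  have w0 : w != 0 by apply: contraTneq (oner_neq0 F) => e; rewrite -fw e /dot mul0mx mxE eqxx.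
  have := R w w0; rewrite dotD !dotZ gu gv !mulr0 addr0 fw hw => /(_ erefl).
  case=> t [c [d [e1 e2]]].
  have c0 : c != 0 by apply: contraTneq (oner_neq0 F) => c0; rewrite e1 c0 rmorph0 mulr0 eqxx.
  have [] := inj (- d) c; last by move=> _ c00; rewrite c00 eqxx in c0.
  by rewrite rmorphN /= e2 -[X in - X + _]mulr1 e1; ring.
have key w w' : w != 0 -> dot g w = 0 -> (dot f w != 0) || (dot h w != 0) ->
    dot f w * dot h w' - dot f w' * dot h w = 0 ->
    exists k l : K, [/\ iota l *: f - iota k *: h != 0,
      dot (iota l *: f - iota k *: h) w = 0 & dot (iota l *: f - iota k *: h) w' = 0].
  move=> w0 gw nz D; have [t [k [l [fw hw]]]] := R w w0 gw.
  have t0 : t != 0 by apply: contraTneq nz => t0; rewrite fw hw t0 !mul0r eqxx.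
  have E x : dot (iota l *: f - iota k *: h) x = iota l * dot f x - iota k * dot h x.
    by rewrite -scaleNr dotDf !dotZf mulNr.
  exists k, l; split.
  - apply/eqP => e; have := E v1; have := E v2; rewrite e fv1 fv2 hv1 hv2 /dot !mulmx0 !mxE.
    rewrite !mulr0 !mulr1 add0r subr0 => /esym/eqP; rewrite oppr_eq0 => /eqP k0 /esym l0.
    by move: nz; rewrite fw hw k0 l0 !mulr0 eqxx.
  - by rewrite E fw hw; ring.
  - apply: (mulfI t0); rewrite E mulr0 -[RHS]oppr0 -[in RHS]D fw hw; ring.
have [u0 v0] := indep_neq0 iuv.
have fin k l : iota l *: f - iota k *: h != 0 ->
    dot (iota l *: f - iota k *: h) u = 0 -> dot (iota l *: f - iota k *: h) v = 0 ->
    exists k l : K, forall v, (dot g v == 0) = (iota l * dot f v - iota k * dot h v == 0).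
  move=> n0 e1 e2; exists k, l => x.
  have -> : iota l * dot f x - iota k * dot h x = dot (iota l *: f - iota k *: h) x.
    by rewrite -scaleNr dotDf !dotZf mulNr.
  apply/eqP/eqP => [gx|ex].
    by have [a [b ->]] := span2 g0 iuv gu gv gx; rewrite dotD !dotZ e1 e2 !mulr0 addr0.
  by have [a [b ->]] := span2 n0 iuv e1 e2 ex; rewrite dotD !dotZ gu gv !mulr0 addr0.
have [nz|/norP[/negbNE/eqP fu /negbNE/eqP hu]] := boolP ((dot f u != 0) || (dot h u != 0)).
  by have [k [l [n0 e1 e2]]] := key _ _ u0 gu nz D0; exact: fin n0 e1 e2.
have [nz|/norP[/negbNE/eqP fv /negbNE/eqP hv]] := boolP ((dot f v != 0) || (dot h v != 0)).
  have D0' : dot f v * dot h u - dot f u * dot h v = 0 by rewrite -[RHS]oppr0 -D0; ring.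
  by have [k [l [n0 e1 e2]]] := key _ _ v0 gv nz D0'; exact: fin n0 e2 e1.
have f0 : f != 0 by apply: contraTneq (oner_neq0 F) => e; rewrite -fv1 e /dot mulmx0 mxE eqxx.
have h0 : h != 0 by apply: contraTneq (oner_neq0 F) => e; rewrite -hv2 e /dot mulmx0 mxE eqxx.
have [a [b e]] := span2 h0 iuv hu hv hv1.
by move/eqP: fv1; rewrite e dotD !dotZ fu fv !mulr0 addr0 eq_sym oner_eq0.
Qed.

Lemma Baer_ratio_combination (x y : F) (k l : K) : Baer_ratio iota x y ->
  iota l * x - iota k * y != 0 ->
  (exists c, x = iota c * (iota l * x - iota k * y)) /\
  (exists d, y = iota d * (iota l * x - iota k * y)).
Proof.
case=> t [c [d [-> ->]]] n0.
have e : iota l * (t * iota c) - iota k * (t * iota d) = t * iota (l * c - k * d).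
  by rewrite rmorphB !rmorphM /=; ring.
have m0 : l * c - k * d != 0.
  by apply: contraNneq n0 => m0; rewrite e m0 rmorph0 mulr0.
rewrite e; split; [exists (c / (l * c - k * d))|exists (d / (l * c - k * d))];
  by rewrite mulrCA -rmorphM /= divfK.
Qed.

(** If the ratio [e / h] takes values in [K] at all [K]-rational points off the
    single [K]-rational zero [x] of [h], then it is constant. For [y], [z]
    completing [x] to a basis, comparing the ratios at [y], [z] and [y + z] gives
    a [K]-linear relation between [h y] and [h z], hence a trivial one; the points
    [x + y] and [x + z] then force [e x = 0]. *)
Lemma const_ratio (e h : 'cV[F]_3) (x : 'rV[K]_3) :
  x != 0 -> (forall y, y != 0 -> dot h (map_mx iota y) = 0 -> pt y = pt x) ->
  dot h (map_mx iota x) = 0 ->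
  (forall y, dot h (map_mx iota y) != 0 ->
     exists k, dot e (map_mx iota y) = iota k * dot h (map_mx iota y)) ->
  exists k, e = iota k *: h.
Proof.
move=> x0 hker hx er.
have [g g1 [_ gx]] := form_through (0 : 'rV[K]_3) x.
have [y gy ixy] := ker_form_other g1 x0; have [z gz] := form_eq1 g1.
have gz0 : dot g z != 0 by rewrite gz oner_neq0.
have S w := span3 w ixy gx gy gz0.
have hD y1 y2 : dot h (map_mx iota (y1 + y2)) = dot h (map_mx iota y1) + dot h (map_mx iota y2).
  by rewrite map_mxD dotD.
have hZ a y1 : dot h (map_mx iota (a *: y1)) = iota a * dot h (map_mx iota y1).
  by rewrite map_mxZ dotZ.
have eD y1 y2 : dot e (map_mx iota (y1 + y2)) = dot e (map_mx iota y1) + dot e (map_mx iota y2).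
  by rewrite map_mxD dotD.
have eZ a y1 : dot e (map_mx iota (a *: y1)) = iota a * dot e (map_mx iota y1).
  by rewrite map_mxZ dotZ.
have hyz a b : dot h (map_mx iota (a *: y + b *: z)) = 0 -> a = 0 /\ b = 0.
  move=> h0; have [e0|n0] := eqVneq (a *: y + b *: z) 0.
    have b0 : b = 0.
      have := congr1 (dot g) e0; rewrite dotD !dotZ gy gz mulr0 add0r mulr1 => ->.
      by rewrite /dot mul0mx mxE.
    move/eqP: e0; rewrite b0 scale0r addr0 scaler_eq0.
    by have [_ /negPf ->] := indep_neq0 ixy; rewrite orbF => /eqP.
  have [c c0 ec] := pt_inj n0 x0 (hker _ n0 h0).
  have b0 : b = 0.
    by have := congr1 (dot g) ec; rewrite dotD !dotZ gy gz gx !mulr0 add0r mulr1.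
  move/eqP: ec; rewrite b0 scale0r addr0 -subr_eq0 addrC -scaleNr => /eqP.
  by case/(indepP _ _ ixy).
pose H a b := dot h (map_mx iota (a *: y + b *: z)).
have HE a b : H a b = iota a * dot h (map_mx iota y) + iota b * dot h (map_mx iota z).
  by rewrite /H hD !hZ.
set hy := dot h (map_mx iota y) in HE; set hz := dot h (map_mx iota z) in HE.
have lin a b : iota a * hy + iota b * hz = 0 -> a = 0 /\ b = 0 by rewrite -HE; exact: hyz.
have hy0 : hy != 0.
  apply/eqP => e0; have [/eqP] := lin 1 0 ltac:(by rewrite e0 rmorph0 mulr0 mul0r addr0).
  by rewrite oner_eq0.
have hz0 : hz != 0.
  apply/eqP => e0; have [_ /eqP] := lin 0 1 ltac:(by rewrite e0 rmorph0 mulr0 mul0r addr0).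
  by rewrite oner_eq0.
have hyz0 : dot h (map_mx iota (y + z)) != 0.
  rewrite hD; apply/eqP => e0; have [/eqP] := lin 1 1 ltac:(by rewrite rmorph1 !mul1r).
  by rewrite oner_eq0.
have hxy0 : dot h (map_mx iota (x + y)) != 0 by rewrite hD hx add0r.
have hxz0 : dot h (map_mx iota (x + z)) != 0 by rewrite hD hx add0r.
have [k1 e1] := er _ hy0; have [k2 e2] := er _ hz0; have [k3 e3] := er _ hyz0.
have [k4 e4] := er _ hxy0; have [k5 e5] := er _ hxz0.
move: e3 e4 e5; rewrite !eD !hD hx !add0r e1 e2 -/hy -/hz => e3 e4 e5.
have [/eqP] := lin (k1 - k3) (k2 - k3) ltac:(by rewrite !rmorphB /= !mulrBl addrACA -opprD e3 -mulrDr subrr).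
rewrite subr_eq0 => /eqP k13 /eqP; rewrite subr_eq0 => /eqP k23.
move: e4 e5; rewrite k13 k23 => e4 e5.
have [/eqP] := lin (k4 - k3) (k3 - k5) ltac:(rewrite !rmorphB /= !mulrBl -e4 -e5; ring).
rewrite subr_eq0 => /eqP k43 _.
have ex : dot e (map_mx iota x) = 0.
  by apply: (addIr (iota k3 * hy)); rewrite e4 k43 add0r.
exists k3.
have E w : dot e (map_mx iota w) = iota k3 * dot h (map_mx iota w).
  have [a [b [c ->]]] := S w.
  by rewrite !eD !hD !eZ !hZ ex hx e1 e2 -/hy -/hz k13 k23; ring.
apply/matrixP => i j; rewrite (ord1 j) mxE; have := E (delta_mx 0 i).
by rewrite map_delta_mx /dot -!rowE !mxE.
Qed.

Lemma subline_of_kline (M : 'M[F]_3) x y : row_free M -> indep x y ->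
  Baer_subline iota (proj_image iota M (kline x y)).
Proof.
move=> fM ixy; have fR := row_free_rows2 ixy.
have fRM : row_free (map_mx iota (rows2 x y) *m M).
  by rewrite /row_free mxrankMfree // mxrank_map.
exists (map_mx iota (rows2 x y) *m M) => //.
apply/setP => P; apply/(proj_imageP _ fM)/(proj_imageP _ fRM).
  case=> z [z0 /(in_kline _ _ z0)[a [b ez]] ->].
  exists (\row_i (if i == 0 then a else b)); rewrite row2_eq0 inE mulmxA -map_mxM mul_row2 -ez.
  split=> //; apply: contraNN z0 => /andP[/eqP a0 /eqP b0].
  by rewrite ez a0 b0 !scale0r addr0.
case=> z [z0 _ ->]; exists (z *m rows2 x y).
have zR : z *m rows2 x y != 0 by rewrite mulmx_free_eq0.
split=> //; last by rewrite mulmxA map_mxM.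
by apply/(in_kline _ _ zR); exists (z 0 0), (z 0 1); rewrite mul_rows2.
Qed.

(** Restricted to the [K]-rational points of the subplane, the two coordinates of
    the pencil are [a + tau b] and [c + tau d] with [K]-linear forms [a], [b], [c],
    [d], so the intersection is the quadric [ad = bc]. This form does not vanish
    identically: the line at infinity is a line of the pencil with only the point
    [T] in the subplane, so by [const_ratio] both coordinates would be multiples
    of the form of that line. *)
Theorem subplane_meets_pencil B (linf : line F 2) (T : point F 2) S :
  Baer_subplane iota B -> B :&: line_points linf = [set T] ->
  linf_Baer_pencil iota linf S ->
  [\/ exists P : point F 2, S :&: B = [set P],
         Baer_subline iota (S :&: B),
         exists b1 b2 : {set point F 2},
           [/\ Baer_subline iota b1, Baer_subline iota b2, b1 <> b2
             & S :&: B = b1 :|: b2]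
       | nondegenerate_Fq_conic iota (S :&: B)].
Proof.
move=> [M uM eB] BT [penS linfS]; have fM : row_free M by rewrite row_free_unit.
have [f [h [nf nh SE]]] := pencil_forms penS.
have [g g0 [eg _]] := line_pointsP linf.
have [tau [inj onto]] := quadratic_basis.
have [a [b ab]] := form_decomp (M *m f) onto; have [c [d cd]] := form_decomp (M *m h) onto.
have dM (e : 'cV[F]_3) x : dot e (map_mx iota x *m M) = dot (M *m e) (map_mx iota x).
  by rewrite /dot mulmxA.
pose A := a *m d^T - b *m c^T.
have QE x : qform A x = dot a x * dot d x - dot b x * dot c x.
  have E (u v : 'cV[K]_3) : (x *m (u *m v^T) *m x^T) 0 0 = dot u x * dot v x.
    rewrite mulmxA -mulmxA -trmx_mul /dot mxE big_ord_recl big_ord0 addr0.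
    by rewrite [(_^T) _ _]mxE.
  have sub00 (X Y : 'M[K]_1) : (X - Y) 0 0 = X 0 0 - Y 0 0 by rewrite !mxE.
  by rewrite /qform /A mulmxBr mulmxBl sub00 !E.
have SB : S :&: B = proj_image iota M (conic A).
  apply/setP => P; rewrite inE eB.
  have conicE x : x != 0 -> (pt (map_mx iota x *m M) \in S) = (pt x \in conic A).
    move=> x0; rewrite in_conic // QE; apply/idP/eqP.
      move/SE => /(_ (image_neq0 iota fM x0)); rewrite !dM ab cd.
      by move/(Baer_ratioE _ _ _ _ inj onto) => ->; rewrite subrr.
    move/eqP; rewrite subr_eq0 => /eqP e; apply/SE; rewrite ?image_neq0 // !dM ab cd.
    exact/(Baer_ratioE _ _ _ _ inj onto).
  apply/andP/(proj_imageP _ fM) => [[PS /(proj_imageP _ fM)[x [x0 _ eP]]]|[x [x0 Ax ->]]].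
    by exists x; split=> //; rewrite -conicE // -eP.
  by rewrite conicE //; split=> //; apply/(proj_imageP _ fM); exists x; rewrite inE.
rewrite SB; case: (conic_cases A) => [nA|z|[v v0 ->]|[x [y [z [ixy ixz cA]]]]].
- by constructor 4; exists M, A.
- exfalso.
  have TB : T \in B :&: line_points linf by rewrite BT set11.
  move: TB; rewrite inE eB => /andP[/(proj_imageP _ fM)[x [x0 _ eT]]].
  rewrite eT eg in_form_line ?image_neq0 // => /eqP gx.
  have ratio y : Baer_ratio iota (dot (M *m f) (map_mx iota y)) (dot (M *m h) (map_mx iota y)).
    rewrite ab cd; apply/(Baer_ratioE _ _ _ _ inj onto).
    by have /eqP := z y; rewrite QE subr_eq0 => /eqP.
  have [|k [l kl]] := pencil_line_form g0 nf nh.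
    move=> v v0 gv; apply/SE => //; apply: (subsetP linfS).
    by rewrite eg in_form_line // gv.
  (* An equation of the line at infinity; its ratios to [f] and [h] are in [K]. *)
  pose h' := iota l *: f - iota k *: h.
  have h'E v : dot h' v = iota l * dot f v - iota k * dot h v.
    by rewrite /h' -scaleNr dotDf !dotZf mulNr.
  have klM y : dot (M *m h') (map_mx iota y) =
     iota l * dot (M *m f) (map_mx iota y) - iota k * dot (M *m h) (map_mx iota y).
    by rewrite -!dM h'E.
  have hker y : y != 0 -> dot (M *m h') (map_mx iota y) = 0 -> pt y = pt x.
    move=> y0; rewrite -dM h'E => /eqP; rewrite -kl => gy.
    apply: (image_inj (iota := iota) fM) => //; apply/eqP; rewrite -in_set1 -eT -BT inE eB eg.
    by rewrite in_form_line ?image_neq0 // gy andbT; apply/(proj_imageP _ fM); exists y; rewrite inE.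
  have hx : dot (M *m h') (map_mx iota x) = 0.
    by apply/eqP; rewrite -dM h'E -kl gx.
  have [v1 [fv1 hv1]] := nf; have [v2 [fv2 hv2]] := nh.
  have MK (e1 e2 : 'cV[F]_3) k' : M *m e1 = iota k' *: (M *m e2) -> e1 = iota k' *: e2.
    by rewrite scalemxAr => /(congr1 (mulmx (invmx M))); rewrite !mulmxA mulVmx // !mul1mx.
  have R1 y : dot (M *m h') (map_mx iota y) != 0 ->
     exists k, dot (M *m f) (map_mx iota y) = iota k * dot (M *m h') (map_mx iota y).
    by rewrite klM => n0; have [] := Baer_ratio_combination (ratio y) n0.
  have R2 y : dot (M *m h') (map_mx iota y) != 0 ->
     exists k, dot (M *m h) (map_mx iota y) = iota k * dot (M *m h') (map_mx iota y).
    by rewrite klM => n0; have [] := Baer_ratio_combination (ratio y) n0.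
  have [k1 /MK e1] := const_ratio x0 hker hx R1.
  have [k2 /MK e2] := const_ratio x0 hker hx R2.
  have k1h : iota k1 * dot h' v1 = 1 by rewrite -dotZf -e1.
  have k2h : iota k2 * dot h' v2 = 1 by rewrite -dotZf -e2.
  have : iota k2 * dot h' v1 = 0 by rewrite -dotZf -e2.
  move/eqP; rewrite mulf_eq0 => /orP[]/eqP e.
    by move/eqP: k2h; rewrite e mul0r eq_sym oner_eq0.
  by move/eqP: k1h; rewrite e mulr0 eq_sym oner_eq0.
- constructor 1; exists (pt (map_mx iota v *m M)); apply/setP => P; rewrite in_set1.
  apply/(proj_imageP _ fM)/eqP => [[x [x0 /set1P e ->]]|->]; last by exists v; rewrite inE.
  have [k k0 ->] := pt_inj x0 v0 e.
  by rewrite map_mxZ -scalemxAl pt_scale ?fmorph_eq0 // image_neq0.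
case: cA => [->|[-> nz]]; first by constructor 2; exact: subline_of_kline.
constructor 3; exists (proj_image iota M (kline x y)), (proj_image iota M (kline x z)).
have [_ z0] := indep_neq0 ixz.
split; [exact: subline_of_kline|exact: subline_of_kline| |].
  move/setP/(_ (pt (map_mx iota z *m M))); rewrite !mem_proj_image // (negPf nz).
  by move/esym/(in_kline _ _ z0); apply; exists 0, 1; rewrite scale0r add0r scale1r.
by rewrite !proj_imageE // imsetU.
Qed.

End SubplaneMeetsPencil.

(** * The pencils with a given vertex at infinity *)

Section PencilCoordinate.
Variables (K F : finFieldType) (iota : {rmorphism K -> F}).

Lemma Baer_ratioP (x y : F) :
  Baer_ratio iota x y <-> x = 0 \/ exists k, y = iota k * x.
Proof.
split=> [[t [c [d [-> ->]]]]|[->|[k ->]]]; last 2 first.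
- by exists y, 0, 1; rewrite rmorph0 rmorph1 mulr0 mulr1.
- by exists x, 1, k; rewrite rmorph1 mulr1 mulrC.
have [->|c0] := eqVneq c 0; first by left; rewrite rmorph0 mulr0.
right; exists (d / c); rewrite rmorphM fmorphV /=; field.
by rewrite fmorph_eq0.
Qed.

(** The line through [c] with direction [a] of the affine plane [AG(2, K)] carried
    by [F]. *)
Definition affine_Baer_line (c a : F) : {set F} := [set c + iota k * a | k in K].

Definition coordinate_pencil (linf : line F 2) (t : point F 2 -> F) c a :=
  line_points linf :|: [set X | t X \in affine_Baer_line c a].

(** The affine lines through a point [P] at infinity are parametrised by [F], and
    the pencils with vertex [P] containing the line at infinity correspond to the
    lines of [AG(2, K)] on [F]. Counting in these affine planes replaces all
    geometry of the pencils in the converse direction. *)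
Lemma pencil_coordinate (linf : line F 2) P : P \in line_points linf ->
  exists t : point F 2 -> F,
    (forall X Y, X \notin line_points linf -> Y \notin line_points linf ->
      (t X = t Y <-> exists2 L, is_line L & [&& P \in L, X \in L & Y \in L])) /\
    (forall c a, a != 0 ->
       linf_Baer_pencil iota linf (coordinate_pencil linf t c a)).
Proof.
have [l l0 [el _]] := line_pointsP linf; have [p p0 ->] := ptP P.
rewrite el in_form_line // => /eqP lp.
have [u lu] := form_eq1 l0; have [r lr ipr] := ker_form_other l0 p0.
have [_ r0] := indep_neq0 ipr.
have iur : indep u r.
  apply/indepP => a b e; have := congr1 (dot l) e.
  rewrite dotD !dotZ lu lr mulr0 addr0 mulr1 /dot mul0mx mxE => a0; split=> //.
  by move/eqP: e; rewrite a0 scale0r add0r scaler_eq0 (negPf r0) orbF => /eqP.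
have [g g0 [gu gr]] := form_through u r.
have gp : dot g p != 0.
  apply/eqP => gp; have [a [b e]] := span2 g0 ipr gp gr gu.
  by move/eqP: lu; rewrite e dotD !dotZ lp lr !mulr0 addr0 eq_sym oner_eq0.
have [f [h [S [fu hu] [fr hr] [fp hp]]]] := dual_basis iur gu gr gp.
have lf x : dot f x = dot l x.
  by have [s e] := S x; rewrite [in RHS]e !dotD !dotZ lu lr lp !mulr0 !addr0 mulr1.
exists (fun X => dot h (vec X) / dot l (vec X)); split.
  move=> X Y; rewrite !inE; set v := vec X; set w := vec Y => lv lw; split.
    set t := dot h v / _ => et.
    have E x : dot (h + (- t) *: l) x = dot h x - t * dot l x by rewrite dotDf dotZf mulNr.
    exists (form_line (h + (- t) *: l)).
      exists (h + (- t) *: l) => //.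
      apply: contraTneq (oner_neq0 F) => e0; have := E r.
      by rewrite e0 hr lr mulr0 subr0 /dot mulmx0 mxE => <-; rewrite eqxx.
    rewrite in_form_line // !inE !E hp lp mulr0 subrr eqxx /= -/v -/w.
    by rewrite {1}/t divfK // subrr eqxx et divfK // subrr eqxx.
  case=> L [e e0 ->]; rewrite in_form_line // !inE => /and3P[/eqP ep /eqP ev /eqP ew].
  have E x : dot e x = dot l x * dot e u + dot h x * dot e r.
    by have [s ex] := S x; rewrite {1}ex !dotD !dotZ ep mulr0 addr0 lf.
  have er0 : dot e r != 0.
    apply: contraNneq e0 => er; apply/eqP/form_ext => x; rewrite E er mulr0 addr0.
    move/eqP: ev; rewrite E er mulr0 addr0 mulf_eq0 (negPf lv) => /eqP ->.
    by rewrite mulr0 /dot mulmx0 mxE.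
  have key x : dot l x != 0 -> dot e x = 0 -> dot h x / dot l x = - dot e u / dot e r.
    move=> lx ex; apply/eqP; rewrite eqr_div // mulNr -addr_eq0; apply/eqP.
    by rewrite -[RHS]ex (E x); ring.
  by rewrite !key.
move=> c a a0.
have iR : indep (u + c *: r) (a *: r).
  apply/indepP => x y; rewrite scalerDr !scalerA -addrA -scalerDl => /(indepP _ _ iur)[-> /eqP].
  by rewrite mul0r add0r mulf_eq0 (negPf a0) orbF => /eqP.
pose R := rows2 (u + c *: r) (a *: r); have fR : row_free R by exact: row_free_rows2.
have R0 : row 0 R = u + c *: r by rewrite rowK.
have R1 : row 1 R = a *: r by rewrite rowK.
pose h' := a^-1 *: (h + (- c) *: l).
have h'E x : dot h' x = (dot h x - c * dot l x) / a.
  by rewrite /h' dotZf dotDf dotZf; ring.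
split; last exact: subsetUl.
have lR : (<<(<<R>>%MS : 'M[F]_3)>>%MS == <<R>>%MS) && (\rank <<R>>%MS == 2%N).
  by rewrite genmx_id eqxx genmxE /=; move: fR; rewrite /row_free.
pose m : line F 2 := exist _ <<R>>%MS lR.
have inm v : (v <= val m)%MS = (dot g v == 0).
  have le : (R <= kermx g)%MS.
    apply/sub_kermxP/row_matrixP => i; rewrite row_mul row0; apply/eqP; rewrite -dot_eq0.
    case: i => [[|[|//]] Hi].
      by rewrite (_ : Ordinal Hi = 0) ?R0; [rewrite dotD dotZ gu gr mulr0 addr0|exact: val_inj].
    by rewrite (_ : Ordinal Hi = 1) ?R1; [rewrite dotZ gr mulr0|exact: val_inj].
  have /eqmxP e : (R == kermx g)%MS.
    by rewrite -(geq_leqif (mxrank_leqif_eq le)) rank_ker_form //; move/eqP: fR => ->.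
  by rewrite genmxE e dot_eq0; apply/sub_kermxP/eqP.
exists (pt p), (proj_image iota R [set: point K 1]), m; split.
- by exists R.
- apply/subsetP => X /(proj_imageP _ fR)[x [x0 _ ->]].
  rewrite inE val_pt ?image_neq0 //.
  by rewrite [val m]/= genmxE submxMl.
- by rewrite inE val_pt // inm.
apply/setP => X; have [v v0 ->] := ptP X.
have C := in_cone iota fR p0 (f := l) (h := h').
have {}C : pt v \in cone (pt p) (proj_image iota R [set: point K 1]) <->
    Baer_ratio iota (dot l v) (dot h' v).
  apply: C => //.
  - move=> x; have [s e] := S x; exists s; rewrite [LHS]e R0 R1 h'E lf.
    rewrite scalerDr !scalerA -[in RHS]addrA; rewrite -!addrA; congr (_ + _).
    by rewrite addrA -scalerDl; congr (_ *: _ + _); field.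
  - by rewrite R0 h'E !dotD !dotZ lu lr hu hr; split; field.
  - by rewrite R1 h'E !dotZ lr hr; split; field.
  - by rewrite h'E hp lp; split=> //; ring.
have tE : pt v \in coordinate_pencil linf (fun X => dot h (vec X) / dot l (vec X)) c a
    = (dot l v == 0) || [exists k, dot h v / dot l v == c + iota k * a].
  rewrite in_setU el in_form_line // inE; congr (_ || _).
  have [s s0 ->] := pt_inj (vec_neq0 (pt v)) v0 (vecK _).
  rewrite !dotZ -mulf_div divff // mul1r.
  by apply/imsetP/existsP => [[k _ ->]|[k /eqP ->]]; exists k.
rewrite tE; apply/orP/idP => [H|/C/Baer_ratioP].
  apply/C/Baer_ratioP; case: H => [/eqP ->|/existsP[k /eqP e]]; first by left.
  have [lv|lv] := eqVneq (dot l v) 0; [by left|right; exists k].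
  rewrite h'E; move/eqP: e; rewrite -subr_eq0 => /eqP e; apply/eqP; rewrite -subr_eq0.
  apply/eqP/(mulIf a0)/(mulIf (invr_neq0 lv)); rewrite mul0r mul0r -[RHS]e.
  by field; rewrite a0 lv.
have [->|lv] := eqVneq (dot l v) 0; first by left.
case=> [/eqP|[k]]; first by rewrite (negPf lv).
rewrite h'E => e; right; apply/existsP; exists k; apply/eqP.
have -> : iota k = iota k * dot l v / dot l v by rewrite mulfK.
by rewrite -e; field; rewrite a0 lv.
Qed.

End PencilCoordinate.

(** * Counting in the affine plane of a vertex *)

Section AffineBaerLines.
Variables (K F : finFieldType) (iota : {rmorphism K -> F}).
Implicit Types (x y a c : F).

Lemma card_affine_Baer_line c a : a != 0 -> #|affine_Baer_line iota c a| = #|K|.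
Proof.
move=> a0; rewrite card_imset // => k l /addrI /(mulIf a0); exact: fmorph_inj.
Qed.

Lemma affine_Baer_line_base c a : c \in affine_Baer_line iota c a.
Proof. by apply/imsetP; exists 0; rewrite // rmorph0 mul0r addr0. Qed.

Lemma affine_Baer_line_tip x y : y \in affine_Baer_line iota x (y - x).
Proof. by apply/imsetP; exists 1; rewrite // rmorph1 mul1r addrC subrK. Qed.

(** Each line of [AG(2, K)] through [x] is counted once per direction vector, that
    is [#|K| - 1] times, instead of being listed as a set. *)
Definition directions x y := [set a in [set~ 0] | y \in affine_Baer_line iota x a].

Lemma directions_self x : directions x x = [set~ 0].
Proof. by apply/setP => a; rewrite !inE affine_Baer_line_base andbT. Qed.

Lemma card_directions x y : y != x -> #|directions x y| = #|K|.-1.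
Proof.
move=> yx; have d0 : y - x != 0 by rewrite subr_eq0.
have -> : directions x y = [set (y - x) / iota k | k in [set~ 0]].
  apply/setP => a; rewrite !inE; apply/andP/imsetP => [[a0 /imsetP[k _ e]]|[k]].
    have k0 : k != 0.
      by apply: contraNneq yx => k0; rewrite e k0 rmorph0 mul0r addr0.
    exists k; first by rewrite !inE.
    by rewrite e addrC addKr mulrC mulKf // fmorph_eq0.
  rewrite !inE => k0 ->; have ik0 : iota k != 0 by rewrite fmorph_eq0.
  rewrite mulf_neq0 ?invr_eq0 //; split=> //; apply/imsetP; exists k => //.
  by rewrite mulrC divfK // addrC subrK.
rewrite card_imset ?cardsC1 // => k l /(mulfI d0)/invr_inj; exact: fmorph_inj.
Qed.

End AffineBaerLines.

Lemma card_rem_in (I : finType) (A : {set I}) x : x \in A -> #|A| = #|A :\ x|.+1.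
Proof. by move=> xA; rewrite (cardsD1 x A) xA. Qed.

Lemma card_rem_notin (I : finType) (A : {set I}) x : x \notin A -> A :\ x = A.
Proof.
move=> xA; apply/setP => y; rewrite in_setD1; case: eqP => [->|//] /=.
by rewrite (negPf xA).
Qed.

Lemma card_rem_le (I : finType) (A : {set I}) x : (#|A| <= #|A :\ x|.+1)%N.
Proof. by rewrite (cardsD1 x A); case: (x \in A). Qed.

Lemma Baer_subline_dec (K F : finFieldType) (iota : {rmorphism K -> F}) b :
  Baer_subline iota b \/ ~ Baer_subline iota b.
Proof.
have [/existsP[M /andP[fM /eqP e]]|N] :=
  boolP [exists M : 'M[F]_(2, 3), row_free M && (b == proj_image iota M [set: point K 1])].
  by left; exists M.
right=> -[M fM e]; case/existsP: N; exists M.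
by rewrite fM e eqxx.
Qed.

Lemma double_count (I J : finType) (A : {set I}) (C : {set J}) (r : I -> J -> bool) :
  (\sum_(i in A) #|[set j in C | r i j]| = \sum_(j in C) #|[set i in A | r i j]|)%N.
Proof.
have E (L : finType) (D : {set L}) (b : pred L) : #|[set l in D | b l]| = (\sum_(l in D) b l)%N.
  rewrite -sum1_card big_mkcond [RHS]big_mkcond; apply: eq_bigr => l _ /=.
  by rewrite inE; case: (l \in D); case: (b l).
under eq_bigr => i _ do rewrite E.
under [RHS]eq_bigr => j _ do rewrite E.
exact: exchange_big.
Qed.

Lemma heavy_count (q n w : nat) : (0 < q)%N -> (w <= q.+1)%N ->
  ((q ^ 2).-1 * q + n * q = w * (q ^ 2).-1 + (q ^ 2 + q - w) * q.-1)%N -> n = (w * q.-1)%N.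
Proof.
case: q => [//|k] _ le; rewrite -[k.+1.-1]/k; have -> : ((k.+1 ^ 2).-1 = k * k.+2)%N by rewrite expnS expn1; nia.
have [m em] : exists m, (k.+1 ^ 2 + k.+1 = m + w)%N.
  exists (k.+1 ^ 2 + k.+1 - w)%N; rewrite subnK //.
  by apply: leq_trans le _; rewrite expnS expn1; nia.
rewrite em addnK => e; apply/eqP; rewrite -(eqn_pmul2r (ltn0Sn k)); apply/eqP.
have : ((k.+1 ^ 2 + k.+1) * k = (m + w) * k)%N by rewrite em.
by move: e; rewrite expnS expn1; clear; nia.
Qed.

(** * A set with the right pencil sections has Baer sublines as secants *)

Section PencilSections.
Variables (K F : finFieldType) (iota : {rmorphism K -> F}).
Local Notation q := #|K|.
Hypothesis cardF : #|F| = (q ^ 2)%N.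
Hypothesis q_gt2 : (2 < q)%N.
Variables (linf : line F 2) (B : {set point F 2}) (T : point F 2).
Local Notation lp := (line_points linf).
Hypothesis cardB : #|B| = (q ^ 2 + q + 1)%N.
Hypothesis BT : B :&: lp = [set T].

Definition pencil_section (C : {set point F 2}) : Prop :=
 [\/ exists P : point F 2, C = [set P],
     Baer_subline iota C,
     exists b1 b2 : {set point F 2},
       [/\ Baer_subline iota b1, Baer_subline iota b2, b1 <> b2 & C = b1 :|: b2]
   | nondegenerate_Fq_conic iota C].

Hypothesis sections : forall S, linf_Baer_pencil iota linf S -> pencil_section (S :&: B).

Implicit Types (X Y Z P : point F 2) (x y z a c : F) (t : point F 2 -> F) (b : {set point F 2}).

Let B' := B :\ T.

Lemma linf_line : is_line lp.
Proof. by have [g g0 [-> _]] := line_pointsP linf; exists g. Qed.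

Lemma TB : T \in B.
Proof. by have := set11 T; rewrite -BT inE => /andP[]. Qed.

Lemma Tlp : T \in lp.
Proof. by have := set11 T; rewrite -BT => /setIP[]. Qed.

Lemma cardB' : #|B'| = (q ^ 2 + q)%N.
Proof. by have := cardsD1 T B; rewrite TB cardB addn1 => -[->]. Qed.

Lemma B'P X : reflect (X \in B /\ X \notin lp) (X \in B').
Proof.
apply: (iffP setD1P) => [[nT XB]|[XB nl]]; split=> //.
  by apply: contraNN nT => Xl; rewrite -in_set1 -BT in_setI XB.
by apply: contraNneq nl => ->; exact: Tlp.
Qed.

Lemma B'B X : X \in B' -> X \in B. Proof. by case/B'P. Qed.
Lemma B'lp X : X \in B' -> X \notin lp. Proof. by case/B'P. Qed.
Lemma B'T X : X \in B' -> X != T. Proof. by case/setD1P. Qed.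

Definition over t (D : {set F}) := [set X in B' | t X \in D].
Definition fiber t x := [set X in B' | t X == x].

Lemma in_over t D X : (X \in over t D) = (X \in B') && (t X \in D).
Proof. by rewrite in_set. Qed.

Lemma in_fiber t x X : (X \in fiber t x) = (X \in B') && (t X == x).
Proof. by rewrite in_set. Qed.

(** What the converse uses of the pencils with vertex [P]: the fibres of [t] are
    the traces of the affine lines through [P], and each line of [AG(2, K)] on [F]
    has one of the four prescribed types. Every pencil contains [T], which is
    therefore split off. *)
Definition coordinate P t :=
  (forall X Y, X \in B' -> Y \in B' ->
     (t X = t Y <-> exists2 L, is_line L & [&& P \in L, X \in L & Y \in L])) /\
  (forall c a, a != 0 -> pencil_section (T |: over t (affine_Baer_line iota c a))).

Lemma exists_coordinate P : P \in lp -> exists t, coordinate P t.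
Proof.
move=> Pl; have [t [col pen]] := pencil_coordinate iota Pl; exists t; split.
  by move=> X Y /B'lp Xl /B'lp Yl; exact: col.
move=> c a a0; have := sections (pen c a a0); congr pencil_section.
apply/setP => X; rewrite /coordinate_pencil in_setI !in_setU !inE.
have [XB|XB] := boolP (X \in B); rewrite ?andbF ?andbT /=; last first.
  by rewrite orbF; apply/esym; apply: contraNF XB => /eqP ->; exact: TB.
have -> : (val X <= val linf)%MS = (X == T).
  by rewrite -in_set1 -BT !inE XB.
by case: eqP.
Qed.

Lemma sum_fibers t : (\sum_x #|fiber t x|)%N = (q ^ 2 + q)%N.
Proof.
rewrite -cardB' -sum1_card (partition_big t predT) //=.
by apply: eq_bigr => x _; rewrite sum1dep_card.
Qed.

(** A Baer subline inside a pencil lies on a line of the pencil or is a transversal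
    of it. A transversal meets the line at infinity, hence contains [T]: it has one
    point more than the pencil has affine lines. *)
Lemma subline_cases P t b (D : {set F}) : coordinate P t -> #|D| = q ->
  Baer_subline iota b -> b \subset T |: over t D ->
  exists2 L, is_line L /\ b \subset L &
    (P \in L -> {in b :\ T &, forall X Y, t X = t Y}) /\
    (P \notin L -> [/\ T \in b, {in b :\ T &, injective t} & t @: (b :\ T) = D]).
Proof.
move=> [col _] cD sb bD; have [L lL bL] := subline_line sb.
have bB X : X \in b :\ T -> [/\ X \in B', X \in L & t X \in D].
  case/setD1P => nT Xb; have := subsetP bD X Xb; rewrite in_setU1 (negPf nT) inE.
  by case/andP => -> ->; rewrite (subsetP bL).
exists L => //; split=> [PL X Y /bB[XB XL _] /bB[YB YL _]|nPL].
  by apply/(col X Y XB YB); exists L => //; rewrite PL XL YL.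
have inj : {in b :\ T &, injective t}.
  move=> X Y /bB[XB XL _] /bB[YB YL _] /(col X Y XB YB)[L' lL' /and3P[PL' XL' YL']].
  by apply/eqP; apply: contraNT nPL => nXY; rewrite (line_eq lL lL' nXY).
have sub : t @: (b :\ T) \subset D by apply/subsetP => _ /imsetP[X /bB[_ _ tX] ->].
have := subset_leq_card sub; rewrite card_in_imset // cD.
have [Tb|nTb] := boolP (T \in b); last first.
  by rewrite (card_rem_notin nTb) (card_subline sb) ltnn.
have [e] : q.+1 = #|b :\ T|.+1 by rewrite -(card_rem_in Tb) (card_subline sb).
move=> _.
split=> //; apply/eqP; rewrite eqEcard sub card_in_imset // cD.
by rewrite -e leqnn.
Qed.

Section VertexT.
Variable t : point F 2 -> F.
Hypothesis tT : coordinate T t.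

(** With vertex [T] there are no transversals, since a transversal would contain
    [T]. *)
Lemma subline_in_fiber b (D : {set F}) : #|D| = q ->
  Baer_subline iota b -> b \subset T |: over t D ->
  exists x, [/\ x \in D, b :\ T \subset fiber t x & b :\ T != set0].
Proof.
move=> cD sb bD; have [L [lL bL] [h1 h2]] := subline_cases tT cD sb bD.
have TL : T \in L by apply: contraT => /[dup] n /h2[Tb _ _]; case/negP: n; exact: (subsetP bL).
have : b :\ T != set0.
  rewrite -card_gt0; have := card_rem_le b T; rewrite (card_subline sb) ltnS.
  by apply: leq_trans; apply: ltn_trans q_gt2.
move=> /[dup] n0 /set0Pn[X Xb]; exists (t X).
have bB Y : Y \in b :\ T -> (Y \in B') && (t Y \in D).
  case/setD1P => nT Yb; have := subsetP bD Y Yb; rewrite in_setU1 (negPf nT) inE.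
  by case/andP => -> ->.
split=> //; first by case/andP: (bB _ Xb).
apply/subsetP => Y Yb; rewrite inE; case/andP: (bB _ Yb) => -> _ /=.
by rewrite (h1 TL Y X).
Qed.

(** The pencil through two lines [x], [y] of the vertex [T], when the trace on [x]
    is not a Baer subline. A conic gives the first alternative. Two sublines give
    the others: either both are on [x], or the one on [x] misses [T] and the other
    contains [T] and is on [y] or elsewhere. *)
Lemma fiber_pair x y : y != x -> fiber t x != set0 ->
  ~ Baer_subline iota (T |: fiber t x) ->
  [\/ (#|fiber t x| <= 1)%N /\ (#|fiber t y| <= 1)%N,
      fiber t y = set0 /\ (#|fiber t x| <= q.*2.+2)%N
    | #|fiber t y| = q /\ #|fiber t x| = q.+1].
Proof.
move=> yx x0 nsx; have d0 : y - x != 0 by rewrite subr_eq0.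
set D := affine_Baer_line iota x (y - x).
have cD : #|D| = q by exact: card_affine_Baer_line.
have xD : x \in D by exact: affine_Baer_line_base.
have yD : y \in D by exact: affine_Baer_line_tip.
have fD z : z \in D -> fiber t z \subset over t D.
  by move=> zD; apply/subsetP => X; rewrite !inE => /andP[-> /eqP ->].
have To : T \notin over t D by rewrite !inE eqxx.
have oT : (T |: over t D) :\ T = over t D by rewrite setU1K.
case: (tT.2 x (y - x) d0); rewrite -/D.
- case=> P e; case/set0Pn: x0 => X Xx.
  have XP : X \in [set P] by rewrite -e in_setU1 (subsetP (fD x xD)) ?orbT.
  have TP : T \in [set P] by rewrite -e setU11.
  move: Xx; rewrite (set1P XP) -(set1P TP) inE => /andP[/B'T].
  by rewrite eqxx.
- move=> sb; have [z [zD bz _]] := subline_in_fiber cD sb (subxx _).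
  rewrite oT in bz; have e : over t D = fiber t z.
    by apply/eqP; rewrite eqEsubset bz fD.
  case/set0Pn: x0 => X Xx; have := subsetP (fD x xD) X Xx; rewrite e.
  move: Xx; rewrite !inE => /andP[_ /eqP ->] /andP[_ /eqP xz].
  by case: nsx; rewrite xz -e.
- case=> b1 [b2 [s1 s2 n12 e]].
  have sub1 : b1 \subset T |: over t D by rewrite e subsetUl.
  have sub2 : b2 \subset T |: over t D by rewrite e subsetUr.
  have [x1 [x1D bx1 b10]] := subline_in_fiber cD s1 sub1.
  have [x2 [x2D bx2 b20]] := subline_in_fiber cD s2 sub2.
  have oE : over t D = (b1 :\ T) :|: (b2 :\ T) by rewrite -setDUl -e oT.
  have disj z w X : X \in fiber t z -> X \in fiber t w -> z = w.
    by rewrite !inE => /andP[_ /eqP <-] /andP[_ /eqP].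
  have fE z X : z \in D -> X \in fiber t z ->
      ((X \in b1 :\ T) /\ z = x1) \/ ((X \in b2 :\ T) /\ z = x2).
    move=> zD Xz; have := subsetP (fD z zD) X Xz; rewrite oE => /setUP[] Xb; [left|right]; split=> //.
      exact: disj Xz (subsetP bx1 X Xb).
    exact: disj Xz (subsetP bx2 X Xb).
  have card1 : #|b1| = q.+1 := card_subline s1; have card2 : #|b2| = q.+1 := card_subline s2.
  have [e12|n12'] := eqVneq x1 x2.
    have xx1 : x = x1.
      by case/set0Pn: x0 => X Xx; case: (fE x X xD Xx) => -[_ ->].
    constructor 2; split.
      apply/eqP; apply/negPn/negP => /set0Pn[X Xy].
      by move: yx; rewrite xx1; case: (fE y X yD Xy) => -[_ ->]; rewrite ?e12 eqxx.
    apply: leq_trans (subset_leq_card (fD x xD)) _; rewrite oE.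
    apply: leq_trans (leq_card_setU _ _).1 _.
    apply: leq_trans (leq_add (subset_leq_card (subsetDl _ _)) (subset_leq_card (subsetDl _ _))) _.
    by rewrite card1 card2 addSn addnS addnn.
  have wlog1 (c1 c2 : {set point F 2}) z1 z2 : Baer_subline iota c1 -> Baer_subline iota c2 ->
      c1 :|: c2 = T |: over t D -> z1 != z2 -> c1 :\ T \subset fiber t z1 ->
      c2 :\ T \subset fiber t z2 -> (forall z X, z \in D -> X \in fiber t z ->
      ((X \in c1 :\ T) /\ z = z1) \/ ((X \in c2 :\ T) /\ z = z2)) -> x = z1 ->
      (fiber t y = set0 /\ (#|fiber t x| <= q.*2.+2)%N) \/ (#|fiber t y| = q /\ #|fiber t x| = q.+1).
    move=> sc1 sc2 ec nz cz1 cz2 fc xz1.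
    have fx : fiber t x = c1 :\ T.
      apply/eqP; rewrite eqEsubset xz1 cz1 andbT -xz1; apply/subsetP => X Xx.
      by case: (fc x X xD Xx) => -[] // _ xz2; rewrite -xz1 xz2 eqxx in nz.
    have nT1 : T \notin c1 by apply/negP => Tc1; apply: nsx; rewrite fx setD1K.
    have T2 : T \in c2 by have := setU11 T (over t D); rewrite -ec inE (negPf nT1).
    have cx : #|fiber t x| = q.+1.
      by rewrite fx (card_rem_notin nT1) (card_subline sc1).
    have [yz2|yz2] := eqVneq y z2.
      right; split=> //; have -> : fiber t y = c2 :\ T.
        apply/eqP; rewrite eqEsubset yz2 cz2 andbT -yz2; apply/subsetP => X Xy.
        by case: (fc y X yD Xy) => -[] // _ yz1; rewrite yz1 xz1 eqxx in yx.
      by have := card_rem_in T2; rewrite (card_subline sc2) => -[<-].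
    left; split; last by rewrite cx -addnn ltnS leqW ?leq_addr.
    apply/eqP; apply/negPn/negP => /set0Pn[X Xy].
    case: (fc y X yD Xy) => -[_ e']; first by rewrite e' xz1 eqxx in yx.
    by rewrite e' eqxx in yz2.
  case/set0Pn: (x0) => X Xx; case: (fE x X xD Xx) => -[_ xi].
    by case: (wlog1 b1 b2 x1 x2) => //; [constructor 2|constructor 3].
  have e21 : b2 :|: b1 = T |: over t D by rewrite setUC.
  have n21 : x2 != x1 by rewrite eq_sym.
  have fE' z Z : z \in D -> Z \in fiber t z ->
      ((Z \in b2 :\ T) /\ z = x2) \/ ((Z \in b1 :\ T) /\ z = x1).
    by move=> zD Zz; case: (fE z Z zD Zz); [right|left].
  by case: (wlog1 b2 b1 x2 x1 s2 s1 e21 n21 bx2 bx1 fE' xi); [constructor 2|constructor 3].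
move=> con; constructor 1.
have le1 z : z \in D -> (#|fiber t z| <= 1)%N.
  move=> zD; apply/card_le1_eqP => X Y Xz Yz; apply/eqP/negPn/negP => nXY.
  have Xo := subsetP (fD z zD) X Xz; have Yo := subsetP (fD z zD) Y Yz.
  move: Xz Yz; rewrite !in_fiber => /andP[XB /eqP tX] /andP[YB /eqP tY].
  have /(tT.1 X Y XB YB)[L lL /and3P[TL XL YL]] : t X = t Y by rewrite tX tY.
  apply: (Fq_conic_line con lL (setU11 T _) _ _ TL XL YL).
  - by rewrite in_setU1 Xo orbT.
  - by rewrite in_setU1 Yo orbT.
  - by rewrite eq_sym (B'T XB).
  - by rewrite eq_sym (B'T YB).
  - by rewrite eq_sym.
by split; apply: le1.
Qed.

(** Summing over all lines through [T]: if the trace on [x] is not a Baer subline,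
    then [fiber_pair] bounds every other trace, and the total [q^2 + q] becomes
    either at most [q^2], or [q + 1] modulo [q], or at most [2q + 2]. *)
Lemma T_fiber_subline X : X \in B' -> Baer_subline iota (T |: fiber t (t X)).
Proof.
move=> XB; set x := t X; case: (Baer_subline_dec iota (T |: fiber t x)) => // ns; exfalso.
have x0 : fiber t x != set0 by apply/set0Pn; exists X; rewrite in_fiber XB eqxx.
have pair y (yx : y != x) := fiber_pair yx x0 ns.
have q0 : (0 < q)%N by apply: ltn_trans q_gt2.
have [le1|gt1] := leqP #|fiber t x| 1.
  have all1 y : (#|fiber t y| <= 1)%N.
    have [->//|yx] := eqVneq y x; case: (pair y yx) => [[_ //]|[-> _]|[_ e]].
      by rewrite cards0.
    by move: le1; rewrite e ltnS leqNgt q0.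
  have : (\sum_(y : F) #|fiber t y| <= \sum_(y : F) 1)%N by apply: leq_sum.
  by rewrite sum_fibers sum1_card cardF -[X in (_ <= X)%N]addn0 leq_add2l leqNgt q0.
have [cx|cx] := eqVneq #|fiber t x| q.+1.
  have : (q %| \sum_(y | y != x) #|fiber t y|)%N.
    apply: dvdn_sum => y yx; case: (pair y yx) => [[le _]|[-> _]|[-> _]] //.
      by move: le; rewrite leqNgt gt1.
    by rewrite cards0.
  have := sum_fibers t; rewrite (bigD1 x) //= cx => e dv.
  have : (q %| q ^ 2 + q)%N by rewrite dvdn_add // dvdn_exp.
  rewrite -e dvdn_addl // -addn1 dvdn_addr // dvdn1 => /eqP q1.
  by move: q_gt2; rewrite q1.
have oth y : y != x -> fiber t y = set0 /\ (#|fiber t x| <= q.*2.+2)%N.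
  move=> yx; case: (pair y yx) => [[le _]|//|[_ e]]; last by rewrite e eqxx in cx.
  by move: le; rewrite leqNgt gt1.
have := sum_fibers t; rewrite (bigD1 x) //= big1 => [|y yx]; last first.
  by have [-> _] := oth y yx; rewrite cards0.
have x1 : x + 1 != x by rewrite -subr_eq0 addrC addKr oner_eq0.
have [_] := oth _ x1; rewrite addn0; move: (#|fiber t x|) => m le e; move: le; rewrite e leqNgt.
by case/negP; move: q_gt2; case: (q) => [|[|[|k]]] // _; rewrite expnS expn1; nia.
Qed.

End VertexT.

Lemma T_coordinate : exists2 t, coordinate T t &
  forall X, X \in B' -> Baer_subline iota (T |: fiber t (t X)).
Proof.
by have [t tT] := exists_coordinate Tlp; exists t => // X; exact: T_fiber_subline.
Qed.

Section VertexP.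
Variable s : point F 2 -> F.
Hypothesis sT : coordinate T s.
Hypothesis s_subline : forall X, X \in B' -> Baer_subline iota (T |: fiber s (s X)).
Variables (P : point F 2) (t : point F 2 -> F).
Hypothesis Pl : P \in lp.
Hypothesis PT : P != T.
Hypothesis tP : coordinate P t.

Lemma T_notin_fiber r x : T \notin fiber r x.
Proof. by rewrite in_fiber !inE eqxx. Qed.

Lemma card_Tfiber X : X \in B' -> #|fiber s (s X)| = q.
Proof.
move/s_subline/card_subline; rewrite cardsU1 T_notin_fiber add1n.
by case.
Qed.

(** So [B] consists of [q + 1] Baer sublines through [T]. *)
Lemma card_Timage : #|s @: B'| = q.+1.
Proof.
have q0 : (0 < q)%N by apply: ltn_trans q_gt2.
apply/eqP; rewrite -(eqn_pmul2r q0) mulSn addnC mulnn -cardB' -[X in _ == X]sum1_card.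
rewrite (partition_big s (mem (s @: B'))) => [|X XB]; last exact: imset_f.
rewrite -sum_nat_const; apply/eqP; apply: eq_bigr => x /imsetP[X XB ->].
by rewrite sum1dep_card -(card_Tfiber XB).
Qed.

Lemma line_PT L : is_line L -> P \in L -> T \in L -> L = lp.
Proof. by move=> lL PL TL; apply: (line_eq lL linf_line PT) => //; exact: Tlp. Qed.

Lemma Tfiber_inj X Y : X \in B' -> Y \in B' -> s X = s Y -> t X = t Y -> X = Y.
Proof.
move=> XB YB /(sT.1 X Y XB YB)[L lL /and3P[TL XL YL]].
case/(tP.1 X Y XB YB) => L' lL' /and3P[PL' XL' YL'].
apply/eqP; apply: contraNT (B'lp XB) => nXY.
have e := line_eq lL lL' nXY XL YL XL' YL'.
have PL : P \in L by rewrite e.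
by rewrite -(line_PT lL PL TL).
Qed.

(** A line not through [T] meets each of the [q + 1] sublines through [T] at most
    once. *)
Lemma card_fiber_le x : (#|fiber t x| <= q.+1)%N.
Proof.
rewrite -card_Timage -(card_in_imset (f := s)); last first.
  move=> X Y; rewrite !in_fiber => /andP[XB /eqP tX] /andP[YB /eqP tY] e.
  by apply: Tfiber_inj => //; rewrite tX tY.
apply/subset_leq_card/imsetS/subsetP => X.
by rewrite in_fiber => /andP[].
Qed.

Lemma subline_Tfiber b X : Baer_subline iota b -> b \subset B -> T \in b ->
  X \in b :\ T -> b :\ T = fiber s (s X).
Proof.
move=> sb bB Tb XbT; have [L lL bL] := subline_line sb.
have bB' Y : Y \in b :\ T -> (Y \in B') && (Y \in L).
  by case/setD1P => YT Yb; rewrite (subsetP bL) // andbT in_setD1 YT (subsetP bB).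
have /andP[XB XL] := bB' X XbT.
apply/eqP; rewrite eqEcard (card_Tfiber XB).
have [<-] : #|b :\ T|.+1 = q.+1 by rewrite -(card_rem_in Tb) (card_subline sb).
rewrite leqnn andbT; apply/subsetP => Y /bB'/andP[YB YL]; rewrite in_fiber YB.
by apply/eqP/(sT.1 Y X YB XB); exists L => //; rewrite (subsetP bL) // YL XL.
Qed.

Lemma subline_through_T b (D : {set F}) : #|D| = q -> Baer_subline iota b ->
  b \subset T |: over t D -> T \in b ->
  {in b :\ T &, injective t} /\ t @: (b :\ T) = D.
Proof.
move=> cD sb bD Tb; have [L [lL bL] [_ h2]] := subline_cases tP cD sb bD.
have [|//] := h2 _; apply/negP => PL.
have := line_PT lL PL (subsetP bL _ Tb) => eL.
have : b \subset [set T].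
  apply/subsetP => X Xb; apply/set1P/eqP; apply/negPn/negP => XT.
  have := subsetP bD X Xb; rewrite in_setU1 (negPf XT) in_over => /andP[/B'lp/negP[]].
  by rewrite -eL (subsetP bL).
move/subset_leq_card; rewrite cards1 (card_subline sb) ltnS leqNgt.
by rewrite (ltn_trans _ q_gt2).
Qed.

Lemma subline_avoiding_T b (D : {set F}) : #|D| = q -> Baer_subline iota b ->
  b \subset T |: over t D -> T \notin b -> exists2 y, y \in D & b = fiber t y.
Proof.
move=> cD sb bD nTb; have [L [lL bL] [h1 h2]] := subline_cases tP cD sb bD.
have PL : P \in L by apply: contraT => /h2[]; rewrite (negPf nTb).
have bB X : X \in b -> (X \in B') && (t X \in D).
  move=> Xb; have := subsetP bD X Xb; rewrite in_setU1 in_over => /orP[/eqP e|//].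
  by rewrite -e Xb in nTb.
have /set0Pn[X Xb] : b != set0 by rewrite -card_gt0 (card_subline sb).
exists (t X); first by case/andP: (bB X Xb).
apply/eqP; rewrite eqEcard (card_subline sb) card_fiber_le andbT.
apply/subsetP => Y Yb; rewrite in_fiber; case/andP: (bB Y Yb) => -> _ /=.
by rewrite (h1 PL Y X) ?card_rem_notin.
Qed.

Definition two_T_sublines (D : {set F}) := exists b1 b2,
  [/\ Baer_subline iota b1, Baer_subline iota b2, T \in b1, T \in b2
    & T |: over t D = b1 :|: b2].

(** What remains to be known of a pencil that meets [B] in one subline through [T]
    and one on its line [y]. *)
Definition heavy_fiber (D : {set F}) := exists y,
  Baer_subline iota (fiber t y) /\
  forall z, z \in D -> z != y -> (#|fiber t z| <= 1)%N.

(** Intersection numbers of the pencils with vertex [P] distinct from [T]. When a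
    subline through [T] and one avoiding [T] occur, the latter fills its line by
    [card_fiber_le], so the transversal meets it. *)
Lemma over_cases (D : {set F}) : #|D| = q -> pencil_section (T |: over t D) ->
  [\/ #|over t D| = 0%N, #|over t D| = q
    | #|over t D| = q.*2 /\ (two_T_sublines D \/ heavy_fiber D)].
Proof.
move=> cD; have To : T \notin over t D by rewrite in_over !inE eqxx.
have cO C : T |: over t D = C -> #|C| = #|over t D|.+1 by move=> <-; rewrite cardsU1 To.
have oB : T |: over t D \subset B.
  rewrite subUset sub1set TB; apply/subsetP => X; rewrite in_over => /andP[XB _].
  exact: B'B.
have oT : (T |: over t D) :\ T = over t D by rewrite setU1K.
case=> [[P0 e]|sb|[b1 [b2 [s1 s2 n12 e]]]|con].
- by constructor 1; have := cO _ e; rewrite cards1 => -[].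
- by constructor 2; have := cO _ erefl; rewrite (card_subline sb) => -[].
- constructor 3.
  have wl (c1 c2 : {set point F 2}) : Baer_subline iota c1 -> Baer_subline iota c2 -> c1 <> c2 ->
      T |: over t D = c1 :|: c2 -> T \in c1 ->
      #|over t D| = q.*2 /\ (two_T_sublines D \/ heavy_fiber D).
    move=> {}s1 {}s2 {}n12 {}e T1.
    have sub1 : c1 \subset T |: over t D by rewrite e subsetUl.
    have sub2 : c2 \subset T |: over t D by rewrite e subsetUr.
    have oE : over t D = (c1 :\ T) :|: (c2 :\ T) by rewrite -setDUl -e oT.
    have [inj1 im1] := subline_through_T cD s1 sub1 T1.
    have [card1] : #|c1 :\ T|.+1 = q.+1 by rewrite -(card_rem_in T1) (card_subline s1).
    have [T2|nT2] := boolP (T \in c2).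
      have [card2] : #|c2 :\ T|.+1 = q.+1 by rewrite -(card_rem_in T2) (card_subline s2).
      split; last by left; exists c1, c2.
      rewrite oE cardsU card1 card2 (_ : _ :&: _ = set0) ?cards0 ?subn0 ?addnn //.
      apply/eqP; apply/negPn/negP => /set0Pn[X /setIP[X1 X2]].
      apply: n12; rewrite -(setD1K T1) -(setD1K T2).
      rewrite (subline_Tfiber s1 (subset_trans sub1 oB) T1 X1).
      by rewrite (subline_Tfiber s2 (subset_trans sub2 oB) T2 X2).
    have [y yD e2] := subline_avoiding_T cD s2 sub2 nT2.
    have : y \in t @: (c1 :\ T) by rewrite im1.
    case/imsetP => Z Z1 yZ.
    have ZB : Z \in B'.
      by case/setD1P: (Z1) => ZT Zc; rewrite in_setD1 ZT (subsetP (subset_trans sub1 oB)).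
    have Z2 : Z \in c2 by rewrite e2 in_fiber ZB yZ eqxx.
    split; last first.
      right; exists y; split; first by rewrite -e2.
      move=> z zD zy; apply/card_le1_eqP => X Y.
      have in1 W : W \in fiber t z -> W \in c1 :\ T /\ t W = z.
        rewrite in_fiber => /andP[WB /eqP tW]; split=> //.
        have : W \in over t D by rewrite in_over WB tW.
        rewrite oE => /setUP[//|/setD1P[_]]; rewrite e2 in_fiber tW (negPf zy) andbF.
        by [].
      by move=> /in1[X1 tX] /in1[Y1 tY]; apply: inj1 => //; rewrite tX tY.
    rewrite oE (card_rem_notin nT2) cardsU card1 (card_subline s2).
    rewrite (_ : _ :&: _ = [set Z]) ?cards1 ?addnS ?subn1 ?addnn //.
    apply/setP => X; rewrite in_setI in_set1; apply/andP/eqP => [[X1 X2]|->//].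
    move: X2; rewrite e2 in_fiber => /andP[_ /eqP tX].
    by apply: inj1 => //; rewrite tX yZ.
  have : T \in b1 :|: b2 by rewrite -e setU11.
  case/setUP => [T1|T2]; first exact: (wl b1 b2).
  by apply: (wl b2 b1 s2 s1 _ _ T2) => [e21|]; [exact: n12 (esym e21)|rewrite e setUC].
constructor 2.
by have := cO _ erefl; rewrite (card_Fq_conic con (setU11 T _)) => -[].
Qed.

Lemma sum_over x : (\sum_(a : F | a != 0%R) #|over t (affine_Baer_line iota x a)|
  = #|fiber t x| * #|F|.-1 + (q ^ 2 + q - #|fiber t x|) * q.-1)%N.
Proof.
transitivity (\sum_(X in B') #|directions iota x (t X)|)%N.
  rewrite (eq_bigl (mem [set~ 0])) => [|a]; last by rewrite !inE.
  exact: double_count.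
rewrite (bigID (fun X => t X == x)) /=; congr (_ + _)%N.
  rewrite (eq_bigr (fun=> #|F|.-1)) => [|X /andP[_ /eqP ->]]; last first.
    by rewrite directions_self cardsC1.
  rewrite sum_nat_const; congr (_ * _)%N; apply: eq_card => X.
  by rewrite in_fiber.
rewrite (eq_bigr (fun=> q.-1)) => [|X /andP[_ nx]]; last exact: card_directions.
rewrite sum_nat_const; congr (_ * _)%N.
rewrite -cardB' -(cardsID (fiber t x) B').
have -> : B' :&: fiber t x = fiber t x.
  by apply/setIidPr/subsetP => X; rewrite in_fiber => /andP[].
rewrite addKn; apply: eq_card => X; rewrite in_setD in_fiber.
by rewrite unfold_in /=; case: (X \in B'); rewrite ?andbF ?andbT.
Qed.

Definition heavy_dirs x :=
  [set a | (a != 0) && (#|over t (affine_Baer_line iota x a)| == q.*2)].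

(** Every pencil through a nonempty line [x] has [q] or [2q] points of [B] off
    [T]; the known sum over all [q + 1] of them shows that as many of them have
    [2q] points as [x] has points. *)
Lemma card_heavy_dirs x : (0 < #|fiber t x|)%N ->
  #|heavy_dirs x| = (#|fiber t x| * q.-1)%N.
Proof.
move=> w0; have q0 : (0 < q)%N by apply: ltn_trans q_gt2.
have := sum_over x.
rewrite (eq_bigr (fun a => q + (a \in heavy_dirs x) * q)%N); last first.
  move=> a a0; rewrite inE a0 /=.
  case: (over_cases (card_affine_Baer_line iota x a0) (tP.2 x a a0)) => [e|->|[-> _]].
  - have : (#|fiber t x| <= #|over t (affine_Baer_line iota x a)|)%N.
      apply/subset_leq_card/subsetP => X; rewrite in_fiber in_over => /andP[-> /eqP ->].
      exact: affine_Baer_line_base.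
    by rewrite e leqNgt w0.
  - by rewrite -addnn -[X in X == _]addn0 eqn_add2l eq_sym eqn0Ngt q0 mul0n addn0.
  - by rewrite eqxx mul1n addnn.
rewrite big_split /= sum_nat_const -big_distrl /=.
have -> : #|[pred a : F | a != 0]| = #|F|.-1 by rewrite cardC1.
have -> : (\sum_(a : F | a != 0%R) (a \in heavy_dirs x) = #|heavy_dirs x|)%N.
  rewrite -sum1_card [RHS]big_mkcond [LHS]big_mkcond /=; apply: eq_bigr => a _.
  by rewrite inE; case: (a != 0).
have := card_fiber_le x; rewrite cardF.
exact: heavy_count.
Qed.

(** A line with two points of [B] lies in two pencils with [2q] points. If neither
    shows the trace to be a Baer subline, both consist of two sublines through
    [T]; a subline of the second passes through a point of the line that the first
    covers as well, so it is one of those of the first. Then the two pencils share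
    a transversal and coincide. *)
Lemma secant_subline x : (1 < #|fiber t x|)%N -> Baer_subline iota (fiber t x).
Proof.
move=> w1; case: (Baer_subline_dec iota (fiber t x)) => // ns; exfalso.
have w0 : (0 < #|fiber t x|)%N by apply: ltn_trans w1.
have q10 : (0 < q.-1)%N by rewrite -ltnS prednK; [exact: ltn_trans q_gt2|apply: ltn_trans q_gt2].
have two a : a \in heavy_dirs x -> a != 0 /\ two_T_sublines (affine_Baer_line iota x a).
  rewrite inE => /andP[a0 /eqP ca]; split=> //.
  case: (over_cases (card_affine_Baer_line iota x a0) (tP.2 x a a0)).
  - by move=> e; move: ca q10; rewrite e; case: (q).
  - move=> e; move: ca q10; rewrite e -addnn -[X in X = _]addn0 => /addnI <-.
    by [].
  case=> _ [//|[y [sy le]]]; have [xy|xy] := eqVneq x y; first by rewrite xy in ns.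
  by have := le x (affine_Baer_line_base _ _ _) xy; rewrite leqNgt w1.
have [a ha] : exists a, a \in heavy_dirs x.
  by apply/set0Pn; rewrite -card_gt0 card_heavy_dirs // muln_gt0 w0.
have [a0 [b1 [b2 [s1 s2 T1 T2 e]]]] := two a ha.
have [a' ha' na'] : exists2 a', a' \in heavy_dirs x & a' \notin [set iota k * a | k in [set~ 0]].
  apply/subsetPn; apply/negP => /subset_leq_card; rewrite card_heavy_dirs // leqNgt.
  rewrite (leq_ltn_trans (leq_imset_card _ _)) // cardsC1.
  by rewrite -[X in (X < _)%N]mul1n ltn_pmul2r.
have [a'0 [c' [d' [sc _ Tc _ e']]]] := two a' ha'.
set D := affine_Baer_line iota x a in e; set D' := affine_Baer_line iota x a' in e'.
have cD : #|D| = q by exact: card_affine_Baer_line.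
have cD' : #|D'| = q by exact: card_affine_Baer_line.
have xD' : x \in D' by exact: affine_Baer_line_base.
have oB E : T |: over t E \subset B.
  rewrite subUset sub1set TB; apply/subsetP => X; rewrite in_over => /andP[XB _].
  exact: B'B.
have subc : c' \subset T |: over t D' by rewrite e' subsetUl.
have sub1 : b1 \subset T |: over t D by rewrite e subsetUl.
have sub2 : b2 \subset T |: over t D by rewrite e subsetUr.
have [_ imc] := subline_through_T cD' sc subc Tc.
have [_ im1] := subline_through_T cD s1 sub1 T1.
have [_ im2] := subline_through_T cD s2 sub2 T2.
have : x \in t @: (c' :\ T) by rewrite imc.
case/imsetP => Z Zc xZ.
have ZB : Z \in B'.
  by case/setD1P: (Zc) => ZT Zc''; rewrite in_setD1 ZT (subsetP (subset_trans subc (oB _))).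
have DD' : D = D'.
  have : Z \in over t D by rewrite in_over ZB -xZ affine_Baer_line_base.
  have -> : over t D = (b1 :\ T) :|: (b2 :\ T).
    by rewrite -setDUl -e setU1K // in_over !inE eqxx.
  have ec := subline_Tfiber sc (subset_trans subc (oB _)) Tc Zc.
  case/setUP => Zb; [rewrite -im1|rewrite -im2]; rewrite -imc ec.
    by rewrite (subline_Tfiber s1 (subset_trans sub1 (oB _)) T1 Zb).
  by rewrite (subline_Tfiber s2 (subset_trans sub2 (oB _)) T2 Zb).
have : x + a' \in D by rewrite DD'; apply/imsetP; exists 1; rewrite // rmorph1 mul1r.
case/imsetP => k _ /addrI ek; case/negP: na'; apply/imsetP; exists k => //.
by rewrite !inE; apply: contraNneq a'0 => k0; rewrite ek k0 rmorph0 mul0r.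
Qed.

End VertexP.

Lemma every_secant_subline X Y L : X \in B -> Y \in B -> X != Y -> is_line L -> X \in L -> Y \in L ->
  Baer_subline iota (L :&: B).
Proof.
have [s sT ss] := T_coordinate.
have thruT Z : Z \in B' -> T \in L -> is_line L -> Z \in L -> Baer_subline iota (L :&: B).
  move=> ZB TL lL ZL; have := ss Z ZB; congr Baer_subline.
  apply/setP => W; rewrite in_setU1 in_fiber in_setI in_setD1.
  have [->|WT] := eqVneq W T; first by rewrite TB TL.
  have [WB|] := boolP (W \in B); rewrite ?andbF ?andbT //=.
  have WB' : W \in B' by rewrite in_setD1 WT.
  apply/eqP/idP => [/(sT.1 W Z WB' ZB)[L' lL' /and3P[TL' WL' ZL']]|WL].
    by rewrite (line_eq lL lL' (B'T ZB)).
  by apply/(sT.1 W Z WB' ZB); exists L => //; rewrite TL WL ZL.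
move=> XB YB XY lL XL YL; have [TL|nTL] := boolP (T \in L).
  have [XT|XT] := eqVneq X T.
    by apply: (thruT Y) => //; rewrite in_setD1 YB -XT eq_sym XY.
  by apply: (thruT X) => //; rewrite in_setD1 XB XT.
have B'L Z : Z \in B -> Z \in L -> Z \in B'.
  by move=> ZB ZL; rewrite in_setD1 ZB andbT; apply: contraNneq nTL => <-.
have XB' := B'L X XB XL; have YB' := B'L Y YB YL.
have [P PL Pl] := lines_meet lL linf_line.
have PT : P != T by apply: contraNneq nTL => <-.
have [t tP] := exists_coordinate Pl.
have eL : L :&: B = fiber t (t X).
  apply/setP => W; rewrite in_fiber in_setI; apply/andP/andP => [[WL WB]|[WB /eqP]].
    have WB' := B'L W WB WL; rewrite WB'; split=> //; apply/eqP/(tP.1 W X WB' XB').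
    by exists L => //; rewrite PL WL XL.
  case/(tP.1 W X WB XB') => L' lL' /and3P[PL' WL' XL']; split; last exact: B'B.
  have PX : P != X by apply: contraNneq (B'lp XB') => <-.
  by rewrite (line_eq lL lL' PX).
rewrite eL; apply: (secant_subline sT ss Pl PT tP).
rewrite -eL; apply/card_gt1P; exists X, Y; split=> //; rewrite in_setI ?XL ?YL //.
Qed.

End PencilSections.

(** * A set whose secants are Baer sublines is a Baer subplane *)

Section Closure.
Variables (K F : finFieldType) (iota : {rmorphism K -> F}).
Local Notation q := #|K|.
Hypothesis q_gt1 : (1 < q)%N.
Variable B : {set point F 2}.
Hypothesis cardB : #|B| = (q ^ 2 + q + 1)%N.
Hypothesis secB : forall X Y L, X \in B -> Y \in B -> X != Y ->
  is_line L -> X \in L -> Y \in L -> Baer_subline iota (L :&: B).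

(** The lines joining a point [X1] of [B] to the [q + 1] points of [B] on a secant
    [L2] carry [q (q + 1)] further points, which is all of [B]; so every secant
    through [X1] is one of these lines. *)
Lemma secants_meet X1 Y1 L1 X2 Y2 L2 Z :
  X1 \in B -> Y1 \in B -> X1 != Y1 -> is_line L1 -> X1 \in L1 -> Y1 \in L1 ->
  X2 \in B -> Y2 \in B -> X2 != Y2 -> is_line L2 -> X2 \in L2 -> Y2 \in L2 ->
  L1 <> L2 -> Z \in L1 -> Z \in L2 -> Z \in B.
Proof.
move=> X1B Y1B n1 l1 X1L Y1L X2B Y2B n2 l2 X2L Y2L n12 Z1 Z2.
apply: contraT => nZ.
have nX1 : X1 \notin L2.
  apply/negP => X12; apply: n12; apply: (line_eq l1 l2 _ X1L Z1 X12 Z2).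
  by apply: contraNneq nZ => <-.
(* [Y] lies on the line joining [X1] to [W]. *)
pose joined (W Y : point F 2) := [exists g : 'cV[F]_3, [&& g != 0, X1 \in form_line g, W \in form_line g & Y \in form_line g]].
have joinedP W Y L : X1 != W -> is_line L -> X1 \in L -> W \in L -> joined W Y = (Y \in L).
  move=> nW lL XL WL; apply/existsP/idP => [[g /and4P[g0 Xg Wg Yg]]|YL].
    have lg : is_line (form_line g) by exists g.
    by rewrite (line_eq lL lg nW XL WL Xg Wg).
  by case: lL XL WL YL => g g0 -> XL WL YL; exists g; rewrite g0 XL WL YL.
have cL2 : #|L2 :&: B| = q.+1 by apply: (@card_subline _ _ iota); exact: secB n2 l2 X2L Y2L.
have sumE : (\sum_(W in B :\ X1) #|[set Y in L2 :&: B | joined W Y]| = q * q.+1)%N.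
  transitivity (\sum_(Y in L2 :&: B) #|[set W in B :\ X1 | joined W Y]|)%N.
    exact: double_count.
  rewrite (eq_bigr (fun=> q)) => [|Y]; first by rewrite sum_nat_const cL2 mulnC.
  rewrite in_setI => /andP[YL YB].
  have nXY : X1 != Y by apply: contraNneq nX1 => ->.
  have [L lL /andP[XL YL']] := line_through X1 Y.
  have := card_subline (secB X1B YB nXY lL XL YL').
  rewrite (card_rem_in (x := X1)) ?in_setI ?XL // => -[<-].
  apply: eq_card => W; rewrite in_set !in_setD1 in_setI.
  have [//|nW] := eqVneq W X1; rewrite /= andbC; congr (_ && _).
  have nW' : X1 != W by rewrite eq_sym.
  have [L' lL' /andP[XL' WL']] := line_through X1 W.
  rewrite (joinedP W Y L' nW' lL' XL' WL'); apply/idP/idP => [YL''|WL''].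
    by rewrite (line_eq lL lL' nXY).
  by rewrite (line_eq lL' lL nW').
have le1 W : W \in B :\ X1 -> (#|[set Y in L2 :&: B | joined W Y]| <= 1)%N.
  case/setD1P => nW WB; have nW' : X1 != W by rewrite eq_sym.
  have [L lL /andP[XL WL]] := line_through X1 W.
  apply/card_le1_eqP => Y Y'; rewrite !in_set !(joinedP _ _ L nW' lL XL WL).
  move=> /andP[/andP[YL2 _] YL] /andP[/andP[Y'L2 _] Y'L].
  apply/eqP/negPn/negP => nY; move: nX1.
  by rewrite -(line_eq lL l2 nY) // XL.
have Y1B' : Y1 \in B :\ X1 by rewrite in_setD1 eq_sym n1.
have z1 : #|[set Y in L2 :&: B | joined Y1 Y]| = 0%N.
  apply/eqP; rewrite cards_eq0; apply/eqP/setP => Y; rewrite in_set in_set0.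
  rewrite (joinedP _ _ L1 n1 l1 X1L Y1L) in_setI; apply/negP => /andP[/andP[YL2 YB] YL1].
  apply: n12; apply: (line_eq l1 l2 _ YL1 Z1 YL2 Z2).
  by apply: contraNneq nZ => <-.
have : (\sum_(W in B :\ X1) #|[set Y in L2 :&: B | joined W Y]| <= #|(B :\ X1) :\ Y1|)%N.
  rewrite (bigD1 Y1) //= z1 add0n -sum1_card.
  rewrite [X in (_ <= X)%N](eq_bigl (fun W => (W \in B :\ X1) && (W != Y1))); last first.
    by move=> W; rewrite in_setD1 andbC.
  by apply: leq_sum => W /andP[WB _]; exact: le1.
have e : (q ^ 2 + q + 1 = #|(B :\ X1) :\ Y1|.+2)%N by rewrite -(card_rem_in Y1B') -(card_rem_in X1B).
by rewrite sumE -ltnS -ltnS -e addn1 ltnS mulnS mulnn addnC ltnn.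
Qed.

(** [secants_meet] for the lines [xy] and [zw]. The forms [k] and [k'] witness that
    the points spanning each line differ, and [g], [h] are equations of the lines. *)
Lemma cross_point (x y z w p : 'rV[F]_3) (k k' g h : 'cV[F]_3) :
  x != 0 -> dot k x = 0 -> dot k y != 0 -> z != 0 -> dot k' z = 0 -> dot k' w != 0 ->
  dot g x = 0 -> dot g y = 0 -> dot g p = 0 -> dot g z != 0 ->
  h != 0 -> dot h z = 0 -> dot h w = 0 -> dot h p = 0 -> p != 0 ->
  pt x \in B -> pt y \in B -> pt z \in B -> pt w \in B -> pt p \in B.
Proof.
move=> x0 kx ky z0 k'z k'w gx gy gp gz h0 hz hw hp p0 xB yB zB wB.
have nz (f : 'cV[F]_3) v : dot f v != 0 -> v != 0.
  by apply: contraNneq => ->; rewrite /dot mul0mx mxE.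
have y0 := nz _ _ ky; have w0 := nz _ _ k'w.
have g0 : g != 0 by apply: contraNneq gz => ->; rewrite /dot mulmx0 mxE.
have neq (f : 'cV[F]_3) u v : u != 0 -> v != 0 -> dot f u = 0 -> dot f v != 0 -> pt u != pt v.
  move=> u0 v0 fu fv; apply/eqP => /(pt_inj u0 v0)[a a0 e].
  by move/eqP: fu; rewrite e dotZ mulf_eq0 (negPf a0) (negPf fv).
apply: (@secants_meet (pt x) (pt y) (form_line g) (pt z) (pt w) (form_line h)) => //;
  rewrite ?in_form_line ?gx ?gy ?gp ?hz ?hw ?hp ?eqxx //.
- exact: neq kx ky.
- by exists g.
- exact: neq k'z k'w.
- by exists h.
- by move/setP/(_ (pt z)); rewrite !in_form_line // hz eqxx (negPf gz).
Qed.

(** Four points of [B], no three collinear, scaled so that the fourth is the sum of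
    the others: two points on each of two secants through a common point. The
    forms are the dual basis. *)
Lemma frame : exists v1 v2 v3 f1 f2 f3 : _,
  [/\ [/\ pt v1 \in B, pt v2 \in B, pt v3 \in B & pt (v1 + v2 + v3) \in B],
      [/\ dot f1 v1 = 1, dot f1 v2 = 0 & dot f1 v3 = 0],
      [/\ dot f2 v1 = 0, dot f2 v2 = 1 & dot f2 v3 = 0]
    & [/\ dot f3 v1 = 0, dot f3 v2 = 0 & dot f3 v3 = 1 :> F]].
Proof.
have [X XB] : exists X, X \in B by apply/set0Pn; rewrite -card_gt0 cardB addn1.
have third Y Z L : Y \in B -> Z \in B -> Y != Z -> is_line L -> Y \in L -> Z \in L ->
    exists W, [/\ W \in B, W \in L, W != Y & W != Z].
  move=> YB ZB nYZ lL YL ZL; have c := card_subline (secB YB ZB nYZ lL YL ZL).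
  have /set0Pn[W] : (L :&: B) :\ Y :\ Z != set0.
    rewrite -card_gt0 -ltnS -ltnS; apply: leq_trans (_ : #|L :&: B| <= _)%N.
      by rewrite c.
    apply: leq_trans (card_rem_le _ Y) _; rewrite ltnS; exact: card_rem_le.
  by rewrite !in_setD1 in_setI => /and4P[WZ WY WL WB]; exists W.
have [U UX] : exists2 U, U \in B & U != X.
  have /set0Pn[U] : B :\ X != set0.
    rewrite -card_gt0 -ltnS -(card_rem_in XB) cardB addn1 ltnS addn_gt0.
    by rewrite (ltn_trans _ q_gt1) // orbT.
  by rewrite in_setD1 => /andP[UX UB]; exists U.
move=> nUX; have [L lL /andP[XL UL]] := line_through X U.
have nXU : X != U by rewrite eq_sym.
have [W1 [W1B W1L W1X W1U]] := third X U L XB UX nXU lL XL UL.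
have [V VB VL] : exists2 V, V \in B & V \notin L.
  apply/subsetPn; apply/negP => sub.
  have := card_subline (secB XB UX nXU lL XL UL); rewrite (setIidPr sub) cardB => e.
  have : (q ^ 2 + q + 1 <= q.+1)%N by rewrite e.
  by rewrite addn1 ltnS -[X in (_ <= X)%N]add0n leq_add2r leqn0 expn_eq0 /= gtn_eqF // (ltn_trans _ q_gt1).
have nXV : X != V by apply: contraNneq VL => <-.
have [L' lL' /andP[XL' VL']] := line_through X V.
have [W2 [W2B W2L W2X W2V]] := third X V L' XB VB nXV lL' XL' VL'.
have nLL : L <> L' by move=> e; rewrite e VL' in VL.
have notL' Y : Y \in L -> Y != X -> Y \notin L'.
  by move=> YL YX; apply/negP => YL'; apply: nLL; apply: (line_eq lL lL' YX).
have W2nL : W2 \notin L.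
  by apply/negP => W2L0; apply: nLL; apply: (line_eq lL lL' W2X).
have UnL' := notL' U UL nUX; have W1nL' := notL' W1 W1L W1X.
have [[g g0 eL] [h h0 eL']] := (lL, lL'); move: UL W1L VL VL' W2L UnL' W1nL' W2nL.
rewrite eL eL' !inE; set u := vec U; set w1 := vec W1; set v := vec V; set w2 := vec W2.
move=> /eqP gu /eqP gw1 gv /eqP hv /eqP hw2 hu hw1 gw2.
have iuw : indep u w1 by rewrite indep_pt ?vec_neq0 // !vecK eq_sym.
have [a [b [c e]]] := span3 w2 iuw gu gw1 gv.
have c0 : c != 0.
  by apply: contraNneq gw2 => c0; rewrite e !dotD !dotZ gu gw1 c0 mul0r !mulr0 !addr0.
have hab : a * dot h u + b * dot h w1 = 0.
  by rewrite -[RHS]hw2 e !dotD !dotZ hv mulr0 addr0.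
have nab : ~ (a = 0 /\ b = 0).
  case=> a00 b00; move: W2V; rewrite -(vecK W2) -(vecK V) -/v -/w2 e a00 b00 !scale0r !add0r.
  by rewrite pt_scale ?vec_neq0 ?eqxx.
have a0 : a != 0.
  apply/eqP => a00; apply: nab; split=> //; move/eqP: hab.
  by rewrite a00 mul0r add0r mulf_eq0 (negPf hw1) orbF => /eqP.
have b0 : b != 0.
  apply/eqP => b00; apply: nab; split=> //; move/eqP: hab.
  by rewrite b00 mul0r addr0 mulf_eq0 (negPf hu) orbF => /eqP.
have iab : indep (a *: u) (b *: w1).
  apply/indepP => x y; rewrite !scalerA => /(indepP _ _ iuw)[/eqP + /eqP].
  by rewrite !mulf_eq0 (negPf a0) (negPf b0) !orbF => /eqP -> /eqP ->.
have gcv : dot g (c *: v) != 0 by rewrite dotZ mulf_neq0.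
have gau : dot g (a *: u) = 0 by rewrite dotZ gu mulr0.
have gbw : dot g (b *: w1) = 0 by rewrite dotZ gw1 mulr0.
have [f1 [f2 [_ [f11 f21] [f12 f22] [f13 f23]]]] := dual_basis iab gau gbw gcv.
exists (a *: u), (b *: w1), (c *: v), f1, f2, ((dot g (c *: v))^-1 *: g).
rewrite -e !pt_scale ?vec_neq0 // !vecK !dotZf gau gbw !mulr0 mulVf //.
Qed.

(** The [K]-structure is fixed by a frame in [B]. The diagonal points of the frame
    are in [B] by [secants_meet]; so are the [K]-rational points of the sides of
    the triangle, by [subline_span]; and a remaining point is the intersection of
    two lines joining a vertex to a point of the opposite side. Equality of
    cardinals finishes. *)
Theorem subplane_of_secants : Baer_subplane iota B.
Proof.
have [v1 [v2 [v3 [f1 [f2 [f3 [[B1 B2 B3 B4] [f11 f12 f13] [f21 f22 f23] [f31 f32 f33]]]]]]]] := frame.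
have fE := (dotD, dotZ, dotDf, dotZf, dotN, f11, f12, f13, f21, f22, f23, f31, f32, f33,
            mulr0, mulr1, addr0, add0r, mul0r, oppr0).
have nz (f : 'cV[F]_3) v : dot f v != 0 -> v != 0.
  by apply: contraNneq => ->; rewrite /dot mul0mx mxE.
have nzf (f : 'cV[F]_3) v : dot f v != 0 -> f != 0.
  by apply: contraNneq => ->; rewrite /dot mulmx0 mxE.
have one := oner_neq0 F.
have v10 : v1 != 0 by apply: (nz f1); rewrite f11.
have v20 : v2 != 0 by apply: (nz f2); rewrite f22.
have v30 : v3 != 0 by apply: (nz f3); rewrite f33.
have B12 : pt (v1 + v2) \in B.
  apply: (@cross_point v1 v2 v3 (v1 + v2 + v3) (v1 + v2) f2 f1 f3 (f1 + (-1) *: f2)) => //;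
    rewrite ?fE ?addrN ?oppr0 ?subrr //.
  - by apply: (nzf _ v1); rewrite !fE.
  - by apply: (nz f1); rewrite !fE.
have B13 : pt (v1 + v3) \in B.
  apply: (@cross_point v1 v3 v2 (v1 + v2 + v3) (v1 + v3) f3 f1 f2 (f1 + (-1) *: f3)) => //;
    rewrite ?fE ?addrN ?oppr0 ?subrr //.
  - by apply: (nzf _ v1); rewrite !fE.
  - by apply: (nz f1); rewrite !fE.
have B23 : pt (v2 + v3) \in B.
  apply: (@cross_point v2 v3 v1 (v1 + v2 + v3) (v2 + v3) f3 f2 f1 (f2 + (-1) *: f3)) => //;
    rewrite ?fE ?addrN ?oppr0 ?subrr //.
  - by apply: (nzf _ v2); rewrite !fE.
  - by apply: (nz f2); rewrite !fE.
have two (f : 'cV[F]_3) x y : f != 0 -> dot f x = 0 -> dot f y = 0 -> indep x y ->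
    pt x \in B -> pt y \in B -> pt (x + y) \in B ->
    forall c d : K, (c != 0) || (d != 0) -> pt (iota c *: x + iota d *: y) \in B.
  move=> f0 fx fy ixy xB yB xyB c d cd; have [x0 y0] := indep_neq0 ixy.
  have lf : is_line (form_line f) by exists f.
  have mem z : z != 0 -> pt z \in B -> dot f z = 0 -> pt z \in form_line f :&: B.
    by move=> z0 zB fz; rewrite in_setI zB in_form_line // fz eqxx.
  have sb : Baer_subline iota (form_line f :&: B).
    by apply: (secB xB yB) => //; rewrite ?in_form_line ?fx ?fy ?eqxx // -indep_pt.
  have xy0 : x + y != 0.
    by apply/eqP => e; have [] := (indepP _ _ ixy) 1 1; [rewrite !scale1r|move/eqP; rewrite oner_eq0].
  have fxy : dot f (x + y) = 0 by rewrite dotD fx fy addr0.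
  have := subline_span sb ixy (mem x x0 xB fx) (mem y y0 yB fy) (mem _ xy0 xyB fxy) cd.
  by case/setIP.
have ind (f f' : 'cV[F]_3) x y : dot f x = 1 -> dot f y = 0 -> dot f' x = 0 -> dot f' y = 1 -> indep x y.
  move=> fx fy f'x f'y; apply/indepP => c d e.
  have := congr1 (dot f) e; have := congr1 (dot f') e.
  by rewrite !fE fx fy f'x f'y !fE /dot !mul0mx !mxE.
have K12 := two f3 v1 v2 (nzf _ v3 _) f31 f32 (ind f1 f2 _ _ f11 f12 f21 f22) B1 B2 B12.
have K13 := two f2 v1 v3 (nzf _ v2 _) f21 f23 (ind f1 f3 _ _ f11 f13 f31 f33) B1 B3 B13.
have K23 := two f1 v2 v3 (nzf _ v1 _) f12 f13 (ind f2 f3 _ _ f22 f23 f32 f33) B2 B3 B23.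
have {}K12 c d := K12 ltac:(by rewrite f33) c d.
have {}K13 c d := K13 ltac:(by rewrite f22) c d.
have {}K23 c d := K23 ltac:(by rewrite f11) c d.
have all3 a b c : [|| a != 0, b != 0 | c != 0] ->
    pt (iota a *: v1 + iota b *: v2 + iota c *: v3) \in B.
  have [->|a0] := eqVneq a 0; first by move=> h; rewrite rmorph0 scale0r add0r K23.
  have [->|b0] := eqVneq b 0; first by move=> h; rewrite rmorph0 scale0r addr0 K13 ?a0.
  have [->|c0] := eqVneq c 0; first by move=> h; rewrite rmorph0 scale0r addr0 K12 ?a0.
  move=> _.
  have [ia0 ib0 ic0] : [/\ iota a != 0, iota b != 0 & iota c != 0] by rewrite !fmorph_eq0.
  apply: (@cross_point v3 (iota a *: v1 + iota b *: v2) v1 (iota b *: v2 + iota c *: v3) _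
      f1 f2 (iota b *: f1 + (- iota a) *: f2) (iota c *: f2 + (- iota b) *: f3)) => //;
    rewrite ?fE //; try by [ring | rewrite fmorph_eq0].
  - by apply: (nzf _ v2); rewrite !fE.
  - by apply: (nz f1); rewrite !fE.
  - by apply: K12; rewrite a0.
  - by apply: K23; rewrite b0.
pose M : 'M[F]_3 := \matrix_i (if i == 0 then v1 else if i == 1 then v2 else v3).
have ME (x : 'rV[F]_3) : x *m M = x 0 0 *: v1 + x 0 1 *: v2 + x 0 (1 + 1) *: v3.
  rewrite mulmx_sum_row !big_ord_recl big_ord0 addr0 !rowK /= addrA.
  by congr (_ *: _ + x _ _ *: _ + x _ _ *: _); apply: val_inj.
have fM : row_free M.
  apply: inj_row_free => x; rewrite ME => e; apply/rowP => i; rewrite mxE.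
  have := congr1 (dot f1) e; have := congr1 (dot f2) e; have := congr1 (dot f3) e.
  rewrite !fE /dot !mul0mx !mxE => x2 x1 x0.
  by case: i => [[|[|[|//]]] ?]; [rewrite -[RHS]x0|rewrite -[RHS]x1|rewrite -[RHS]x2];
    congr (x _ _); apply: val_inj.
exists M; first by rewrite -row_free_unit.
apply/esym/eqP; rewrite eqEcard card_proj_image // cardsT card_point2 cardB leqnn andbT.
apply/subsetP => P /(proj_imageP _ fM)[x [x0 _ ->]]; rewrite ME !mxE; apply: all3.
apply: contraNT x0; rewrite !negb_or !negbK => /and3P[/eqP x0 /eqP x1 /eqP x2].
apply/eqP/rowP => i; rewrite mxE.
by case: i => [[|[|[|//]]] ?]; [rewrite -[RHS]x0|rewrite -[RHS]x1|rewrite -[RHS]x2];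
    congr (x _ _); apply: val_inj.
Qed.

End Closure.

Local Close Scope ring_scope.

Theorem theorem3 (p e q : nat) (p_prime : prime p) (q_pp : q = p ^ e)
    (q_ge5 : 5 <= q)
    (K F : finFieldType) (iota : {rmorphism K -> F})
    (cardK : #|K| = q) (cardF : #|F| = q ^ 2)
    (linf : line F 2) (B : {set point F 2})
    (cardB : #|B| = q ^ 2 + q + 1)
    (T : point F 2) (BT : B :&: line_points linf = [set T]) :
  Baer_subplane iota B <->
  (forall S : {set point F 2}, linf_Baer_pencil iota linf S ->
     [\/ exists P : point F 2, S :&: B = [set P],
         Baer_subline iota (S :&: B),
         exists b1 b2 : {set point F 2},
           [/\ Baer_subline iota b1, Baer_subline iota b2, b1 <> b2
             & S :&: B = b1 :|: b2]
       | nondegenerate_Fq_conic iota (S :&: B)]).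
Proof.
rewrite -cardK in cardF cardB q_ge5.
split=> [sB S|sections]; first exact: (subplane_meets_pencil cardF sB BT).
have q2 : (2 < #|K|)%N by apply: leq_trans q_ge5.
apply: subplane_of_secants => //; first exact: ltn_trans q2.
move=> X Y L XB YB XY lL XL YL.
exact: (every_secant_subline cardF q2 cardB BT sections XB YB).
Qed.
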